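(* Let $v^*\in\Delta$ be a linearly stable equilibrium. Then $\mathbb P(v_n\to v^* )>0$.
   Context: Let $N\ge2$, $E=\{1,\dots,N\}$, $\alpha>1$, and let $A=(A_{i,j})_{i,j\le N}$ be a symmetric matrix with nonnegative entries, $A_{i,j}>0$ for $i\ne j$, and $\sum_j A_{i,j}$ independent of $i$. Let $(X_n)_{n\ge0}$ be a process on $E$ with arbitrary initial state such that, with $\mathcal F_n=\sigma(X_k;k\le n)$ and $Z_n(j)=\sum_{\ell=0}^n\mathbf 1_{\{X_\ell=j\}}$, $\mathbb P(X_{n+1}=j\mid\mathcal F_n)=\dfrac{A_{X_n,j}(1+Z_n(j))^\alpha}{\sum_{k\le N}A_{X_n,k}(1+Z_n(k))^\alpha}$, and let $v_n(i)=Z_n(i)/(n+1)$. Let $\Delta=\{v\in\mathbb R_+^N:\ \sum_i v_i=1,\ v_i\le 3/4 \text{ whenever } A_{i,i}=0\}$. For $v$ with nonnegative coordinates let $v^\alpha=(v_i^\alpha)_i$, $H(v)=\sum_{i,j}A_{i,j}v_i^\alpha v_j^\alpha$, $\pi_i(v)=v_i^\alpha(Av^\alpha)_i/H(v)$, and on $\Delta$ let $F(v)=-v+\pi(v)$. An equilibrium is $v\in\Delta$ with $F(v)=0$; with $DF(v)$ the differential at $v$ of $v\mapsto -v+\pi(v)$ acting on $\{x:\sum_ix_i=0\}$, an equilibrium is linearly stable if all eigenvalues of $DF(v)$ have negative real parts. *)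

(* Defs.v *)
From HB Require Import structures.
From mathcomp Require Import all_boot all_order all_algebra.
From mathcomp Require Import all_classical all_reals all_analysis.
Set Implicit Arguments. Unset Strict Implicit. Unset Printing Implicit Defensive.
Import Order.TTheory GRing.Theory Num.Theory.
Import numFieldNormedType.Exports.
Local Open Scope classical_set_scope.
Local Open Scope ring_scope.

Section VRRW.
Variables (R : realType) (N : nat) (alpha : R) (A : 'M[R]_N).

Definition Zcount (x : nat -> 'I_N) (n : nat) (j : 'I_N) : nat :=
  \sum_(l < n.+1) (x l == j).

Definition occ (x : nat -> 'I_N) (n : nat) : 'rV[R]_N :=
  \row_i ((Zcount x n i)%:R / (n.+1)%:R).

Definition vrrw_kernel (x : nat -> 'I_N) (n : nat) (j : 'I_N) : R :=
  A (x n) j * ((1 + (Zcount x n j)%:R) `^ alpha) /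
  \sum_(k < N) A (x n) k * ((1 + (Zcount x n k)%:R) `^ alpha).

Definition Delta : set 'rV[R]_N :=
  [set v | (forall i, 0 <= v ord0 i) /\ \sum_i v ord0 i = 1 /\
           (forall i, A i i = 0 -> v ord0 i <= 3 / 4)].

(* v^alpha, extended to all of R^N by |v_i|^alpha (agrees with v_i^alpha on R_+^N) *)
Definition vpow (v : 'rV[R]_N) : 'rV[R]_N := \row_i (`|v ord0 i| `^ alpha).

Definition Hfun (v : 'rV[R]_N) : R :=
  \sum_i \sum_j A i j * vpow v ord0 i * vpow v ord0 j.

Definition pi_map (v : 'rV[R]_N) : 'rV[R]_N :=
  \row_i (vpow v ord0 i * (\sum_j A i j * vpow v ord0 j) / Hfun v).

Definition Ffield (v : 'rV[R]_N) : 'rV[R]_N := - v + pi_map v.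

Definition equilibrium (v : 'rV[R]_N) : Prop := Delta v /\ Ffield v = 0.

Definition tangent (x : 'rV[R]_N) : Prop := \sum_i x ord0 i = 0.

(* a + i b (a, b real, not both 0, in the complexified tangent space) is an
   eigenvector of DF(v) with eigenvalue re + i im *)
Definition DF_eigenvalue (v : 'rV[R]_N) (re im : R) : Prop :=
  exists a b : 'rV[R]_N, (a != 0 \/ b != 0) /\ tangent a /\ tangent b /\
    'd Ffield v a = re *: a - im *: b /\
    'd Ffield v b = im *: a + re *: b.

Definition linearly_stable (v : 'rV[R]_N) : Prop :=
  equilibrium v /\ forall re im, DF_eigenvalue v re im -> re < 0.

End VRRW.

(* Main.v *)
(* With w_n(i) = (1 + Z_n(i)) / (n + 1 + N) the walk has transition matrix K_w(i,j) =
   A_ij w_j^alpha / (A w^alpha)_i at w = w_n, and w_{n+1} = w_n + (e_{X_{n+1}} - w_n) / (n + 2 + N).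
   K_w is reversible with stationary law pi(w).

   The differential of F at an equilibrium v is self-adjoint for <x, y> = sum x_i y_i / v_i (weight 1
   where v_i = 0), so its largest Rayleigh quotient on the tangent space is an eigenvalue. Linear
   stability therefore gives <w - v, F(w)> <= -c V(w) near v, with V(w) = <w - v, w - v>. The Markovian
   noise e_{X_{n+1}} - pi(w_n) is removed by solving the Poisson equation of K_w; its solution is
   locally Lipschitz in w, so V plus a correction of order 1/n contracts on average, up to O(1/n^2).
   Multiplying by a slowly diverging factor a_n (a tail of the harmonic series) still gives a
   nonnegative supermartingale, up to a deterministic term of order a_n / n. By the maximal
   inequality a_n V(w_n) stays bounded forever with positive probability, which forces w_n -> v,
   provided that it starts small enough at a large time n_0. Such a start has positive probability:
   moving by steps that keep the occupation defect, corrected by the Poisson solution, below its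
   average growth yields an admissible path with V(w_n) = O(1/n). *)
Require Import Defs.
From HB Require Import structures.
From mathcomp Require Import all_boot all_order all_algebra.
From mathcomp Require Import all_classical all_reals all_analysis.
From mathcomp Require Import ring lra.
Set Implicit Arguments. Unset Strict Implicit. Unset Printing Implicit Defensive.
Import Order.TTheory GRing.Theory Num.Theory.
Import numFieldNormedType.Exports.
Local Open Scope classical_set_scope.
Local Open Scope ring_scope.

(** * The power function *)

Section AbsPow.
Variables (R : realType) (alpha : R).
Hypothesis alpha_gt1 : 1 < alpha.

(* Off 0 this is 1/t, so that the derivative of t^alpha is alpha t^alpha * weight t,
   also at t = 0. *)
Definition weight (t : R) : R := if t == 0 then 1 else t^-1.

Lemma weight_gt0 t : 0 <= t -> 0 < weight t.
Proof.
rewrite /weight le_eqVlt eq_sym; case: eqVneq => //= _ t0.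
by rewrite invr_gt0.
Qed.

Lemma weight_ge1 t : 0 <= t <= 1 -> 1 <= weight t.
Proof.
rewrite /weight; case: eqVneq => // t0 /andP[tge0 tle1].
by rewrite invf_ge1// lt_def t0.
Qed.

(** At [t = 0] the difference quotient has absolute value [|h|^(alpha-1)], which tends to 0 because
    [alpha > 1]. The absolute value makes the derivative two-sided there, so that points on the
    boundary of the orthant cause no trouble. *)
Lemma is_derive_abs_powR (t : R) : 0 <= t ->
  is_derive t 1 (fun s : R => `|s| `^ alpha) (alpha * `|t| `^ alpha * weight t).
Proof.
rewrite le_eqVlt => /orP[/eqP <-|t0].
  rewrite normr0 powR0 ?mulr0 ?mul0r; last by rewrite gt_eqF// (lt_trans _ alpha_gt1).
  have lim0 : (fun h : R => h^-1 * (`|h + 0| `^ alpha - `|0 : R| `^ alpha)) @ (0:R)^' --> (0:R).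
    apply/cvgrPdist_le => e e0; near=> h.
    have h0 : h != 0 by near: h; exact: nbhs_dnbhs_neq.
    have he : `|h| <= e `^ (alpha - 1)^-1 by near: h; apply: dnbhs0_le; rewrite powR_gt0.
    have {he} He : `|h| `^ (alpha - 1) <= e.
      have a1 : 0 < alpha - 1 by rewrite subr_gt0.
      have := @ge0_ler_powR _ (alpha - 1) (ltW a1) _ _ (normr_ge0 h) (powR_ge0 _ _) he.
      by rewrite -powRrM mulVf ?gt_eqF// powRr1// ltW.
    rewrite !sub0r !normrN addr0 normr0 powR0 ?subr0; last first.
      by rewrite gt_eqF// (lt_trans _ alpha_gt1).
    rewrite normrM normfV (ger0_norm (powR_ge0 _ _)).
    rewrite -(@mulr_powRB1 _ `|h| alpha)//; last by rewrite (lt_trans _ alpha_gt1).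
    by rewrite mulKf ?normr_eq0.
  have E : (fun h : R => h^-1 *: (((fun s : R => `|s| `^ alpha) \o shift 0) (h *: 1) -
     `|0 : R| `^ alpha)) = (fun h => h^-1 * (`|h + 0| `^ alpha - `|0 : R| `^ alpha)).
    by apply/funext => h; rewrite /= /GRing.scale/= mulr1.
  apply: DeriveDef.
    by apply/cvg_ex; exists 0; rewrite /= E.
  by apply/cvg_lim => //; rewrite E.
rewrite /weight gt_eqF// gtr0_norm// -mulrA.
have -> : t `^ alpha * t^-1 = t `^ (alpha - 1).
  by rewrite -(@mulr_powRB1 _ t alpha) ?(ltW t0) ?(lt_trans _ alpha_gt1)// mulrAC divff ?mul1r// gt_eqF.
apply: (@near_eq_is_derive _ _ _ (fun s : R => s `^ alpha)); last exact: is_derive1_powR.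
by near=> s; rewrite gtr0_norm//; near: s; exact: lt_nbhsr.
Unshelve. all: by end_near. Qed.

(** Mean value theorem on the segment between [|s|] and [|t|], where the derivative
    [alpha x^(alpha-1)] is at most [alpha M^(alpha-1)]. *)
Lemma abs_powR_lipschitz (M : R) : 0 <= M ->
  forall s t : R, `|s| <= M -> `|t| <= M ->
  `| `|s| `^ alpha - `|t| `^ alpha| <= alpha * M `^ (alpha - 1) * `|s - t|.
Proof.
move=> M0.
have a0 : 0 < alpha by rewrite (lt_trans _ alpha_gt1).
suff H (a b : R) : 0 <= a -> a <= b -> b <= M ->
    `|b `^ alpha - a `^ alpha| <= alpha * M `^ (alpha - 1) * (b - a).
  move=> s t sM tM.
  apply: (@le_trans _ _ (alpha * M `^ (alpha - 1) * `| `|s| - `|t| |)); last first.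
    by rewrite ler_wpM2l ?mulr_ge0 ?powR_ge0 ?(ltW a0)// ler_dist_dist.
  have [st|/ltW st] := leP `|s| `|t|.
    by rewrite distrC [X in _ * X]distrC [X in _ * X]ger0_norm ?subr_ge0// H.
  by rewrite [X in _ * X]ger0_norm ?subr_ge0// H.
move=> a_ge0 ab bM.
have D (x : R) : 0 <= x -> is_derive x 1 (fun s : R => `|s| `^ alpha)
   (alpha * `|x| `^ alpha * weight x) by exact: is_derive_abs_powR.
have Dab x : x \in `[a, b] -> is_derive x 1 (fun s : R => `|s| `^ alpha)
   (alpha * `|x| `^ alpha * weight x).
  by move=> xab; apply: D; rewrite (le_trans a_ge0)// (itvP xab).
have [x xab E] := @MVT_segment _ (fun s : R => `|s| `^ alpha) _ _ _ ab
  (fun x xab => Dab x (subset_itv_oo_cc xab))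
  (derivable_within_continuous (fun x xab => @ex_derive _ _ _ _ _ _ _ (Dab x xab))).
move: E; rewrite /= (ger0_norm a_ge0) (ger0_norm (le_trans a_ge0 ab)) => ->.
have x0 : 0 <= x by rewrite (le_trans a_ge0)// (itvP xab).
rewrite ger0_norm ?mulr_ge0 ?powR_ge0 ?(ltW a0) ?subr_ge0 ?(ltW (weight_gt0 x0))//.
rewrite ler_wpM2r ?subr_ge0// -mulrA ler_wpM2l ?(ltW a0)//.
rewrite ger0_norm//.
have [->|xn0] := eqVneq x 0.
  by rewrite powR0 ?gt_eqF// mul0r powR_ge0.
rewrite /weight (negPf xn0) -(@mulr_powRB1 _ x alpha)// mulrAC divff// mul1r.
rewrite ge0_ler_powR ?subr_ge0 ?(ltW alpha_gt1) ?nnegrE//.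
by rewrite (le_trans _ bM)// (itvP xab).
Qed.
End AbsPow.

(** * The differential of the vector field *)

Section DiffTools.
Variables (R : realType) (V : normedModType R).

Lemma is_diff_bigsum (I : Type) (s : seq I) (f df : I -> V -> R) (x : V) :
  (forall i, is_diff x (f i) (df i)) ->
  is_diff x (fun y => \sum_(i <- s) f i y) (fun y => \sum_(i <- s) df i y).
Proof.
move=> Hf; elim: s => [|i s IH].
  under eq_fun do rewrite big_nil.
  by under [X in is_diff _ _ X]eq_fun do rewrite big_nil; exact: is_diff_cst.
under eq_fun do rewrite big_cons.
by under [X in is_diff _ _ X]eq_fun do rewrite big_cons; exact: is_diffD.
Qed.

Lemma is_diff_mul (f g df dg : V -> R) (x : V) :
  is_diff x f df -> is_diff x g dg ->
  is_diff x (fun y => f y * g y) (fun y => f x * dg y + g x * df y).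
Proof. by move=> ? ?; exact: is_diffM. Qed.

Lemma is_diff_inv (f df : V -> R) (x : V) : f x != 0 ->
  is_diff x f df -> is_diff x (fun y => (f y)^-1) (fun y => - (f x) ^- 2 * df y).
Proof.
move=> fx0 [dfx <-]; apply: DiffDef; first exact: differentiableV.
by rewrite diffV.
Qed.

Lemma is_diff_mulc (f df : V -> R) (c : R) (x : V) :
  is_diff x f df -> is_diff x (fun y => c * f y) (fun y => c * df y).
Proof. by move=> Hf; exact: is_diffZ. Qed.

End DiffTools.

Section Differential.
Variables (R : realType) (N : nat) (alpha : R) (A : 'M[R]_N).
Hypothesis alpha_gt1 : 1 < alpha.
Hypothesis Asym : A^T = A.
Variable v : 'rV[R]_N.
Hypothesis v_ge0 : forall i, 0 <= v ord0 i.

Let Vp : 'rV[R]_N -> 'rV[R]_N := vpow alpha.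

Definition Avpow (w : 'rV[R]_N) i := \sum_j A i j * vpow alpha w ord0 j.

Let q := Avpow.
Let H := Hfun alpha A.

Definition dvpow (x : 'rV[R]_N) i :=
  alpha * vpow alpha v ord0 i * weight (v ord0 i) * x ord0 i.

Definition dFfield (x : 'rV[R]_N) : 'rV[R]_N := \row_i
  (- x ord0 i +
   ((dvpow x i * q v i + Vp v ord0 i * \sum_j A i j * dvpow x j) / H v -
    2 * Vp v ord0 i * q v i * (\sum_j q v j * dvpow x j) / H v ^+ 2)).

Lemma HfunE w : Hfun alpha A w = \sum_i vpow alpha w ord0 i * Avpow w i.
Proof.
apply: eq_bigr => i _; rewrite mulr_sumr; apply: eq_bigr => j _.
by rewrite mulrCA mulrA.
Qed.

Lemma is_diff_coord i : is_diff v (fun w : 'rV[R]_N => w ord0 i : R) (fun x => x ord0 i).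
Proof.
apply: DiffDef; first exact: differentiable_coord.
apply/funext => x; rewrite -deriveE; last exact: differentiable_coord.
apply/cvg_lim => //.
apply: cvg_near_cst; near=> h.
rewrite /= !mxE addrK /GRing.scale/= mulKf//; near: h; exact: nbhs_dnbhs_neq.
Unshelve. all: by end_near. Qed.

Lemma is_diff_vpow i : is_diff v (fun w => vpow alpha w ord0 i) (dvpow ^~ i).
Proof.
have D := is_derive_abs_powR alpha_gt1 (v_ge0 i).
have D1 : is_diff (v ord0 i) (fun s : R => `|s| `^ alpha)
    (fun h => alpha * `|v ord0 i| `^ alpha * weight (v ord0 i) * h).
  have /= df := @ex_derive _ _ _ _ _ _ _ D.
  split; first exact/derivable1_diffP.
  rewrite deriv1E// derive1E derive_val; apply/funext => h.
  by rewrite /GRing.scale/= mulrC.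
have D2 := is_diff_coord i.
have := @is_diff_comp _ _ _ _ _ _ _ _ _ D2 D1.
rewrite (_ : _ \o _ = (fun w => vpow alpha w ord0 i)); last first.
  by apply/funext => w; rewrite /= mxE.
rewrite (_ : (_ \o _) = dvpow ^~ i)//.
by apply/funext => w; rewrite /dvpow /= mxE.
Qed.

Lemma is_diff_Avpow i :
  is_diff v (fun w => q w i) (fun x => \sum_j A i j * dvpow x j).
Proof.
by apply: is_diff_bigsum => j; apply: is_diff_mulc; exact: is_diff_vpow.
Qed.

(** The factor 2 comes from the symmetry of [A], which makes the two halves of the product rule
    equal. *)
Lemma is_diff_Hfun : is_diff v H (fun x => 2 * \sum_j q v j * dvpow x j).
Proof.
rewrite (_ : H = fun w => \sum_i Vp w ord0 i * q w i); last first.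
  by apply/funext => w; exact: HfunE.
apply: is_diff_eq.
  by apply: is_diff_bigsum => i; apply: is_diff_mul; [exact: is_diff_vpow|exact: is_diff_Avpow].
apply/funext => x; rewrite big_split/= mulr_natl mulr2n; congr (_ + _).
under eq_bigr do rewrite mulr_sumr.
rewrite exchange_big/=; apply: eq_bigr => j _.
rewrite /q /Avpow mulr_suml; apply: eq_bigr => i _.
have -> : A j i = A i j by rewrite -{1}Asym mxE.
by rewrite mulrCA mulrA.
Qed.

Hypothesis H_neq0 : H v != 0.

Lemma is_diff_Ffield_coord i :
  is_diff v (fun w => Ffield alpha A w ord0 i) (fun x => dFfield x ord0 i).
Proof.
rewrite (_ : (fun w => _) = (fun w : 'rV[R]_N => -1 * w ord0 i + Vp w ord0 i * q w i * (H w)^-1)); last first.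
  by apply/funext => w; rewrite !mxE mulN1r.
have Dp := is_diff_vpow i.
have Dq := is_diff_Avpow i.
have DH := is_diff_inv H_neq0 is_diff_Hfun.
apply: is_diff_eq.
  exact: (is_diffD (is_diff_mulc (-1) (is_diff_coord i)) (is_diff_mul (is_diff_mul Dp Dq) DH)).
apply/funext => x; rewrite /= fctE/= mulN1r !mxE.
by field.
Qed.

Lemma differentiable_Ffield : differentiable (Ffield alpha A) v.
Proof.
rewrite (_ : Ffield alpha A = \sum_(i < N) (fun w => Ffield alpha A w ord0 i *: delta_mx ord0 i)).
  apply: differentiable_sum => i; apply: differentiableZl.
  by have [] := is_diff_Ffield_coord i.
by apply/funext => w; rewrite fct_sumE {1}[Ffield alpha A w]row_sum_delta.
Qed.

Lemma diff_Ffield x : 'd (Ffield alpha A) v x = dFfield x.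
Proof.
have D := differentiable_Ffield.
rewrite -deriveE// derive_mx; last exact: diff_derivable.
apply/rowP => i; rewrite mxE.
by have [d1 d2] := is_diff_Ffield_coord i; rewrite deriveE// d2.
Qed.

End Differential.

(** * Spectral gap of the differential and drift near a stable equilibrium *)

Lemma normr_coord_le (R : realType) (m n : nat) (x : 'M[R]_(m, n)) i j : `|x i j| <= `|x|.
Proof.
rewrite [leRHS]/Num.Def.normr/= mx_normrE.
exact: (@le_bigmax _ _ _ 0 (fun ij : 'I_m * 'I_n => `|x ij.1 ij.2|) (i, j)).
Qed.

Lemma mx_norm_le (R : realType) (m n : nat) (x : 'M[R]_(m, n)) (e : R) : 0 <= e ->
  (forall i j, `|x i j| <= e) -> `|x| <= e.
Proof.
move=> e0 xe; rewrite [leLHS]/Num.Def.normr/= mx_normrE.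
by apply: bigmax_le => // -[i j] _; exact: xe.
Qed.

Section SpectralGap.
Variables (R : realType) (N : nat) (alpha : R) (A : 'M[R]_N).
Hypothesis alpha_gt1 : 1 < alpha.
Hypothesis Asym : A^T = A.
Variable v : 'rV[R]_N.
Hypothesis v_ge0 : forall i, 0 <= v ord0 i.
Hypothesis v_le1 : forall i, v ord0 i <= 1.
Hypothesis H_neq0 : Hfun alpha A v != 0.

Implicit Types x y z : 'rV[R]_N.

Let m i := weight (v ord0 i).

Definition wprod (x y : 'rV[R]_N) : R := \sum_i weight (v ord0 i) * x ord0 i * y ord0 i.

Let dF := dFfield alpha A v.

Lemma dFfieldD a x y : dF (a *: x + y) = a *: dF x + dF y.
Proof. by rewrite /dF -!(diff_Ffield alpha_gt1)// linearP. Qed.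

Lemma wprodC x y : wprod x y = wprod y x.
Proof. by apply: eq_bigr => i _; rewrite mulrAC. Qed.

Lemma wprodDl a x y z : wprod (a *: x + y) z = a * wprod x z + wprod y z.
Proof.
rewrite /wprod mulr_sumr -big_split/=; apply: eq_bigr => i _.
by rewrite !mxE; ring.
Qed.

Lemma wprodDr a x y z : wprod z (a *: x + y) = a * wprod z x + wprod z y.
Proof. by rewrite wprodC wprodDl !(wprodC z). Qed.

Lemma wprod0 x : wprod x 0 = 0.
Proof. by rewrite /wprod big1// => i _; rewrite mxE mulr0. Qed.

Lemma wprodZl a x y : wprod (a *: x) y = a * wprod x y.
Proof. by rewrite -[a *: x]addr0 wprodDl (wprodC 0) wprod0 addr0. Qed.

Lemma wprodZr a x y : wprod x (a *: y) = a * wprod x y.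
Proof. by rewrite wprodC wprodZl wprodC. Qed.

(** All weights are at least 1 because the coordinates of [v] lie in [0, 1]. *)
Lemma sqr_coord_le_wprod x i : x ord0 i ^+ 2 <= wprod x x.
Proof.
rewrite /wprod (bigD1 i)//=.
have M j : 1 <= weight (v ord0 j) by rewrite weight_ge1// v_ge0 v_le1.
rewrite -[leLHS]addr0 lerD//.
  by rewrite -mulrA -expr2 ler_peMl ?sqr_ge0.
by rewrite sumr_ge0// => j _; rewrite -mulrA -expr2 mulr_ge0 ?sqr_ge0// (le_trans _ (M j)).
Qed.

Lemma wprod_ge0 x : 0 <= wprod x x.
Proof.
rewrite sumr_ge0// => j _; rewrite -mulrA -expr2 mulr_ge0 ?sqr_ge0//.
exact/ltW/weight_gt0.
Qed.

Lemma sqr_norm_le_wprod x : `|x| ^+ 2 <= wprod x x.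
Proof.
rewrite -(@sqr_sqrtr _ (wprod x x)) ?wprod_ge0// ler_sqr ?nnegrE ?sqrtr_ge0//.
apply: mx_norm_le => [|i j]; first exact: sqrtr_ge0.
rewrite ord1 -sqrtr_sqr ler_wsqrtr//; exact: sqr_coord_le_wprod.
Qed.

Lemma wprod_eq0 x : wprod x x = 0 -> x = 0.
Proof.
move=> x0; apply/eqP; rewrite -normr_eq0 -sqrf_eq0 eq_le sqr_ge0 andbT -x0.
exact: sqr_norm_le_wprod.
Qed.

Lemma normr_wprod_le x y : `|wprod x y| <= (\sum_i weight (v ord0 i)) * `|x| * `|y|.
Proof.
rewrite (le_trans (ler_norm_sum _ _ _))// -mulrA mulr_suml ler_sum// => i _.
rewrite !normrM ger0_norm ?(ltW (weight_gt0 _))// -mulrA ler_wpM2l ?(ltW (weight_gt0 _))//.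
by rewrite ler_pM// normr_coord_le.
Qed.

(** After multiplication by [alpha], the weight turns [alpha * m i * p i * y i] into [dvpow y i].
    The form then splits into a diagonal form, the form of the symmetric matrix [A] in the vectors
    [dvpow], and a rank-one form, each of them symmetric. *)
Lemma dFfield_selfadjoint x y : wprod (dF x) y = wprod x (dF y).
Proof.
have a0 : alpha != 0 by rewrite gt_eqF// (lt_trans _ alpha_gt1).
apply: (mulfI a0).
suff E x' y' : alpha * wprod (dF x') y' = - alpha * wprod x' y' +
   (alpha * (\sum_i alpha * vpow alpha v ord0 i * Avpow alpha A v i * m i * m i * x' ord0 i * y' ord0 i) +
    \sum_i \sum_j A i j * dvpow alpha v y' i * dvpow alpha v x' j) / Hfun alpha A v -
   2 * (\sum_i Avpow alpha A v i * dvpow alpha v y' i) * (\sum_j Avpow alpha A v j * dvpow alpha v x' j)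
     / Hfun alpha A v ^+ 2.
  rewrite [in RHS]wprodC !E wprodC; congr (_ + _ / _ - _); last first.
    by congr (_ / _); rewrite -!mulrA; congr (_ * _); exact: mulrC.
  congr (_ * _ + _); first by apply: eq_bigr => i _; rewrite mulrAC.
  rewrite exchange_big; apply: eq_bigr => i _; apply: eq_bigr => j _.
  have -> : A j i = A i j by rewrite -{1}Asym mxE.
  by rewrite mulrAC.
set H := Hfun alpha A v; set q := Avpow alpha A v; set u := dvpow alpha v.
set p := fun i => vpow alpha v ord0 i.
transitivity (\sum_i (- alpha * (m i * x' ord0 i * y' ord0 i) +
   (alpha * (alpha * p i * q i * m i * m i * x' ord0 i * y' ord0 i) +
     u y' i * \sum_j A i j * u x' j) / H -
   2 * (q i * u y' i) * (\sum_j q j * u x' j) / H ^+ 2)).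
  rewrite mulr_sumr; apply: eq_bigr => i _; rewrite mxE -/H -/q -/u.
  set s1 := \sum_j _; set s2 := \sum_j _; rewrite /u /dvpow -/(p i) -/(m i).
  by field.
rewrite sumrB big_split/= -!mulr_suml -!mulr_sumr big_split/= -mulr_sumr.
congr (_ + (_ + _) / _ - _).
apply: eq_bigr => i _; rewrite mulr_sumr; apply: eq_bigr => j _.
by rewrite mulrCA mulrA.
Qed.

(** The coordinates of [pi_map] sum to 1 where [Hfun] is nonzero, so its differential sums to 0 and
    only the summand [- x] contributes. *)
Lemma dFfield_sum x : \sum_i dF x ord0 i = - \sum_i x ord0 i.
Proof.
rewrite -sumrN; under eq_bigr do rewrite mxE.
rewrite big_split/= -[RHS]addr0; congr (_ + _).
rewrite sumrB -!mulr_suml.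
set q := Avpow alpha A v; set H := Hfun alpha A v.
set u := dvpow alpha v x.
have -> : \sum_i (2 * vpow alpha v ord0 i * q i) = 2 * H.
  rewrite /H HfunE mulr_sumr; apply: eq_bigr => i _; by rewrite mulrA.
rewrite big_split/=.
have -> : \sum_i vpow alpha v ord0 i * \sum_j A i j * u j = \sum_j q j * u j.
  under eq_bigr do rewrite mulr_sumr.
  rewrite exchange_big/=; apply: eq_bigr => j _.
  rewrite mulr_suml; apply: eq_bigr => i _.
  have -> : A j i = A i j by rewrite -{1}Asym mxE.
  by rewrite mulrCA mulrA.
have -> : \sum_i u i * q i = \sum_j q j * u j by apply: eq_bigr => i _; exact: mulrC.
by field.
Qed.

Lemma tangent_dFfield x : tangent x -> tangent (dF x).
Proof. by rewrite /tangent dFfield_sum => ->; rewrite oppr0. Qed.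

Lemma tangentD a (x y : 'rV[R]_N) : tangent x -> tangent y -> tangent (a *: x + y).
Proof.
rewrite /tangent => x0 y0; under eq_bigr do rewrite !mxE.
by rewrite big_split/= -mulr_sumr x0 y0 mulr0 addr0.
Qed.

Lemma continuous_wprod_diag : continuous (fun x => wprod x x).
Proof.
move=> x; apply: differentiable_continuous.
have D : is_diff x (fun x => wprod x x) (fun y => \sum_i (weight (v ord0 i) * x ord0 i * y ord0 i
   + x ord0 i * (weight (v ord0 i) * y ord0 i))).
  apply: is_diff_bigsum => i; apply: is_diff_mul; last exact: is_diff_coord.
  by apply: is_diff_mulc; exact: is_diff_coord.
by case: D.
Qed.

Lemma continuous_rayleigh : continuous (fun x => wprod (dF x) x).
Proof.
have Dd y i : is_diff y (fun x => dF x ord0 i : R) (fun x => dF x ord0 i).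
  have D := is_diff_Ffield_coord alpha_gt1 Asym v_ge0 H_neq0 i.
  case: (D) => D1 D2.
  rewrite /dF -D2; split; last by apply: diff_lin; exact: diff_continuous.
  by apply: linear_differentiable; exact: diff_continuous.
move=> x; apply: differentiable_continuous.
have D : is_diff x (fun x => wprod (dF x) x) (fun y => \sum_i (weight (v ord0 i) * dF x ord0 i * y ord0 i
   + x ord0 i * (weight (v ord0 i) * dF y ord0 i))).
  apply: is_diff_bigsum => i; apply: is_diff_mul; exact: is_diff_coord.
by case: D.
Qed.

Lemma continuous_coord_sum : continuous (fun x : 'rV[R]_N => \sum_i x ord0 i).
Proof.
move=> x; apply: differentiable_continuous.
have D : is_diff x (fun x : 'rV[R]_N => \sum_i x ord0 i : R) (fun x => \sum_i x ord0 i).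
  by apply: is_diff_bigsum => i; exact: is_diff_coord.
by case: D.
Qed.

Let sphere := [set x : 'rV[R]_N | tangent x /\ wprod x x = 1].

Lemma compact_wsphere : compact sphere.
Proof.
apply: bounded_closed_compact.
  exists 1; split; first exact: num_real.
  move=> M M1 x [_ x1]; apply: le_trans (ltW M1).
  by rewrite -(@expr_le1 _ 2)// -x1 sqr_norm_le_wprod.
have -> : sphere = (fun x : 'rV[R]_N => \sum_i x ord0 i) @^-1` [set 0] `&`
    (fun x => wprod x x) @^-1` [set 1] by [].
apply: closedI; apply: closed_comp; try exact: closed_eq.
  by move=> x _; exact: continuous_coord_sum.
by move=> x _; exact: continuous_wprod_diag.
Qed.

(* The maximum of the Rayleigh quotient over the tangent space is attained at an eigenvector. *)
Lemma spectral_gap :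
  (forall re im, DF_eigenvalue alpha A v re im -> re < 0) ->
  exists2 c, 0 < c & forall x, tangent x -> wprod (dF x) x <= - c * wprod x x.
Proof.
move=> stable.
have normalize x : tangent x -> x != 0 ->
    let y := (Num.sqrt (wprod x x))^-1 *: x in sphere y.
  move=> Tx x0 y; have B0 : 0 < wprod x x.
    rewrite lt_neqAle wprod_ge0 andbT eq_sym; apply: contra x0 => /eqP/wprod_eq0 ->; exact: eqxx.
  split.
    by rewrite /y -[_ *: x]addr0; apply: tangentD => //; rewrite /tangent big1// => i _; rewrite mxE.
  rewrite /y wprodZl wprodZr mulrA -expr2 exprVn.
  by rewrite sqr_sqrtr ?(ltW B0)// mulVf// gt_eqF.
have dF0 : dF 0 = 0.
  by rewrite /dF -(diff_Ffield alpha_gt1)// linear0.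
(* If the sphere is empty, 0 is the only tangent vector and any constant works. *)
have [ne|/set0P/negP] := pselect (sphere !=set0); last first.
  rewrite negbK => /eqP S0.
  exists 1 => // x Tx; have [->|x0] := eqVneq x 0; first by rewrite !wprod0 mulr0.
  by have := normalize _ Tx x0; rewrite S0.
have [x0] := EVT_max_rV ne compact_wsphere (continuous_subspaceT continuous_rayleigh).
rewrite inE => -[Tx0 Bx0] max0.
pose mu := wprod (dF x0) x0.
have phi_ge0 y : tangent y -> wprod (dF y) y <= mu * wprod y y.
  move=> Ty; have [->|y0] := eqVneq y 0; first by rewrite !wprod0 mulr0.
  have Sy := normalize _ Ty y0; have := max0 _ (mem_set Sy).
  have B0 : 0 < wprod y y.
    rewrite lt_neqAle wprod_ge0 andbT eq_sym; apply: contra y0 => /eqP/wprod_eq0 ->; exact: eqxx.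
  set s := Num.sqrt _; have s0 : 0 < s by rewrite sqrtr_gt0.
  rewrite (_ : dF _ = s^-1 *: dF y) ?wprodZl ?wprodZr; last first.
    by rewrite -[in LHS](addr0 (_ *: y)) dFfieldD dF0 addr0.
  rewrite !mulrA -!invfM -expr2 sqr_sqrtr ?wprod_ge0// mulrC ler_pdivrMr//.
have eig : dF x0 = mu *: x0.
  have [y Ey] : exists y, y = - mu *: x0 + dF x0 by exists (- mu *: x0 + dF x0).
  have Ty : tangent y by rewrite Ey; apply: tangentD => //; exact: tangent_dFfield.
  suff /wprod_eq0 : wprod y y = 0.
    by move/eqP; rewrite Ey scaleNr addrC subr_eq0 => /eqP.
  (* Maximality of the quotient at [x0], tested at [x0 + t y] with [y = dF x0 - mu x0]: the left
     side is linear in [t] and the right side quadratic, so small [t > 0] forces [y = 0]. *)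
  have key t : 2 * t * wprod y y <= t ^+ 2 * (mu * wprod y y - wprod (dF y) y).
    have := phi_ge0 (t *: y + x0) (tangentD t Ty Tx0).
    rewrite dFfieldD !wprodDl !wprodDr Bx0 -/mu.
    rewrite (dFfield_selfadjoint y x0) (wprodC x0 y) (wprodC (dF x0) y).
    have -> : wprod y (dF x0) = wprod y y + mu * wprod y x0.
      by rewrite {3}Ey wprodDr mulNr addrAC addNr add0r.
    lra.
  set b := wprod y y in key *; set c := _ - _ in key.
  have b0 : 0 <= b by exact: wprod_ge0.
  apply/eqP; rewrite eq_le b0 andbT leNgt; apply/negP => bgt0.
  have c0 : 0 < `|c| + 1 by rewrite ltr_wpDl.
  pose t := b / (`|c| + 1); have t0 : 0 < t by rewrite divr_gt0.
  have tb : t * (`|c| + 1) = b by rewrite divfK// gt_eqF.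
  have K : 2 * b <= t * c by rewrite -(ler_pM2l t0); have := key t; lra.
  have : t * c <= t * `|c| by rewrite ler_pM2l// ler_norm.
  lra.
have mu0 : mu < 0.
  (* A real eigenvector is a complex one with imaginary part 0. *)
  apply: (stable mu 0); exists x0, 0; split.
    left; apply/eqP => x00; move: Bx0; rewrite x00 wprod0 => /esym/eqP; rewrite oner_eq0//.
  split=> //; split; first by rewrite /tangent big1// => i _; rewrite mxE.
  by rewrite !(diff_Ffield alpha_gt1)// -/dF eig dF0 !scaler0 scale0r subr0 addr0.
exists (- mu); first by rewrite oppr_gt0.
by move=> x Tx; rewrite opprK phi_ge0.
Qed.

(** First-order expansion of the field at its zero [v]: the linear part contracts at the rate of the
    spectral gap, and near [v] the remainder costs at most half of it. *)
Lemma drift_near :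
  (forall re im, DF_eigenvalue alpha A v re im -> re < 0) ->
  Ffield alpha A v = 0 ->
  exists c rho, [/\ 0 < c, 0 < rho & forall w, tangent (w - v) -> `|w - v| <= rho ->
    wprod (w - v) (Ffield alpha A w) <= - c * wprod (w - v) (w - v)].
Proof.
move=> /spectral_gap[c c0 gap] Fv0.
pose M := \sum_i weight (v ord0 i).
have M0 : 0 <= M by rewrite sumr_ge0// => i _; exact/ltW/weight_gt0.
have D := differentiable_Ffield alpha_gt1 Asym v_ge0 H_neq0.
have /eqaddoP/= := diff_locally D.
(* Pairing a remainder of size [e |h|] with [h] costs at most [M e |h|^2]; this [e] makes the cost
   at most [c / 2 * |h|^2]. *)
have e0 : 0 < c / 2 / (M + 1) by rewrite !divr_gt0// ltr_wpDl.
move=> /(_ _ e0)/nbhs_ballP[r/= r0 Hr].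
exists (c / 2), (r / 2); split; [by rewrite divr_gt0|by rewrite divr_gt0|].
move=> w Tw wr.
have := Hr (w - v); rewrite -ball_normE/= sub0r normrN => /(_ _)/wrap[].
  by rewrite (le_lt_trans wr)// ltr_pdivrMr// ltr_pMr// ltr1n.
set h := w - v; rewrite !fctE/= subrK Fv0 add0r (diff_Ffield alpha_gt1)// -/dF => Hh.
have -> : Ffield alpha A w = 1 *: dF h + (Ffield alpha A w - dF h) by rewrite scale1r subrKC.
rewrite wprodDr mul1r wprodC.
have := gap _ Tw; rewrite -/h.
have : wprod h (Ffield alpha A w - dF h) <= c / 2 * wprod h h.
  rewrite (le_trans (ler_norm _))// (le_trans (normr_wprod_le _ _))// -/M.
  rewrite (@le_trans _ _ (M * `|h| * (c / 2 / (M + 1) * `|h|)))// ?ler_wpM2l ?mulr_ge0//.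
  rewrite (@le_trans _ _ (c / 2 * `|h| ^+ 2))//; last first.
    by rewrite ler_wpM2l ?sqr_norm_le_wprod// ltW// divr_gt0.
  rewrite (_ : _ * _ = M / (M + 1) * (c / 2 * `|h| ^+ 2)); last by ring.
  rewrite ler_piMl ?mulr_ge0 ?sqr_ge0 ?(ltW c0) ?invr_ge0//.
  by rewrite ler_pdivrMr ?ltr_wpDl// mul1r lerDl.
lra.
Qed.

End SpectralGap.

(** * The Poisson equation *)

Section LocallyLipschitz.
Variables (R : realType) (V : normedModType R) (v : V).
Implicit Types f g : V -> R.

(** A class closed under all operations in Cramer's rule, through which the Poisson solution
    inherits the property from the coordinates of [w]. *)
Definition loclip f := exists C rho, [/\ 0 <= C, 0 < rho & forall w w',
  `|w - v| <= rho -> `|w' - v| <= rho -> `|f w - f w'| <= C * `|w - w'|].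

Lemma loclip_bounded f : loclip f ->
  exists C rho, [/\ 0 <= C, 0 < rho & forall w, `|w - v| <= rho -> `|f w| <= C].
Proof.
move=> [C [r [C0 r0 H]]]; exists (`|f v| + C * r), r; split => //.
  by rewrite addr_ge0 ?mulr_ge0 ?(ltW r0).
move=> w wr; rewrite -(subrK (f v) (f w)) addrC (le_trans (ler_normD _ _))// lerD2l.
have vr : `|v - v| <= r by rewrite subrr normr0 ltW.
by rewrite (le_trans (H _ _ wr vr))// ler_wpM2l.
Qed.

Lemma loclip_cst c : loclip (fun=> c).
Proof. by exists 0, 1; split => // w w' _ _; rewrite subrr normr0 mul0r. Qed.

Lemma loclipD f g : loclip f -> loclip g -> loclip (fun w => f w + g w).
Proof.
move=> [C [r [C0 r0 H]]] [C' [r' [C'0 r'0 H']]].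
exists (C + C'), (Num.min r r'); split; [exact: addr_ge0|by rewrite lt_min r0|].
move=> w w'; rewrite !le_min => /andP[wr wr'] /andP[w'r w'r'].
by rewrite opprD addrACA mulrDl (le_trans (ler_normD _ _))// lerD ?H ?H'.
Qed.

Lemma loclipM f g : loclip f -> loclip g -> loclip (fun w => f w * g w).
Proof.
move=> lf lg.
have [B [s [B0 s0 Bf]]] := loclip_bounded lf.
have [B' [s' [B'0 s'0 Bg]]] := loclip_bounded lg.
move: lf lg => [C [r [C0 r0 H]]] [C' [r' [C'0 r'0 H']]].
exists (B * C' + C * B'), (Num.min (Num.min r r') (Num.min s s')); split.
- by rewrite addr_ge0 ?mulr_ge0.
- by rewrite !lt_min r0 r'0 s0.
move=> w w'; rewrite !le_min => /andP[/andP[wr wr'] /andP[ws ws']] /andP[/andP[w'r w'r'] /andP[w's w's']].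
have -> : f w * g w - f w' * g w' = f w * (g w - g w') + (f w - f w') * g w' by ring.
rewrite (le_trans (ler_normD _ _))// !normrM mulrDl -mulrA [C * B']mulrC -[B' * C * _]mulrA.
rewrite [`|f w - _| * _]mulrC.
by rewrite lerD// ler_pM ?Bf ?Bg ?H ?H'.
Qed.

Lemma loclip_inv f : f v != 0 -> loclip f -> loclip (fun w => (f w)^-1).
Proof.
move=> fv0 [C [r [C0 r0 H]]].
have c0 : 0 < `|f v| by rewrite normr_gt0.
(* Within this radius [f] moves by at most [|f v| / 2], so it stays away from 0. *)
pose s := Num.min r (`|f v| / 2 / (C + 1)).
have s0 : 0 < s by rewrite lt_min r0 !divr_gt0// ltr_wpDl.
have low w : `|w - v| <= s -> `|f v| / 2 <= `|f w|.
  rewrite le_min => /andP[wr ws].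
  have : `|f w - f v| <= `|f v| / 2.
    have vr : `|v - v| <= r by rewrite subrr normr0 ltW.
    rewrite (le_trans (H _ _ wr vr))//.
    move: ws; rewrite ler_pdivlMr ?ltr_wpDl// => ws.
    by rewrite (le_trans _ ws)// mulrC ler_wpM2l// lerDl.
  have := lerB_normD (f v) (f w - f v); rewrite subrKC; lra.
exists (C / (`|f v| / 2) ^+ 2), s; split => //; first by rewrite divr_ge0// sqr_ge0.
move=> w w' ws w's; have lw := low _ ws; have lw' := low _ w's.
have d0 : 0 < `|f v| / 2 by rewrite divr_gt0.
have fw0 : f w != 0 by rewrite -normr_gt0 (lt_le_trans d0).
have fw'0 : f w' != 0 by rewrite -normr_gt0 (lt_le_trans d0).
have -> : (f w)^-1 - (f w')^-1 = (f w' - f w) / (f w * f w') by field; rewrite fw0 fw'0.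
rewrite normrM normfV normrM distrC mulrAC ler_pM ?invr_ge0 ?mulr_ge0//.
  by apply: H; [move: ws|move: w's]; rewrite le_min => /andP[].
rewrite lef_pV2 ?posrE; first by rewrite expr2 ler_pM// ltW.
  by rewrite mulr_gt0// normr_gt0.
by rewrite exprn_gt0.
Qed.

Lemma loclip_sum (I : Type) (s : seq I) (P : pred I) (f : I -> V -> R) :
  (forall i, loclip (f i)) -> loclip (fun w => \sum_(i <- s | P i) f i w).
Proof.
move=> lf; elim: s => [|i s IH].
  by under eq_fun do rewrite big_nil; exact: loclip_cst.
under eq_fun do rewrite big_cons; case: (P i) => //; exact: loclipD.
Qed.

Lemma loclip_prod (I : Type) (s : seq I) (P : pred I) (f : I -> V -> R) :
  (forall i, loclip (f i)) -> loclip (fun w => \prod_(i <- s | P i) f i w).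
Proof.
move=> lf; elim: s => [|i s IH].
  by under eq_fun do rewrite big_nil; exact: loclip_cst.
under eq_fun do rewrite big_cons; case: (P i) => //; exact: loclipM.
Qed.

Lemma loclip_det n (M : V -> 'M[R]_n) : (forall i j, loclip (fun w => M w i j)) ->
  loclip (fun w => \det (M w)).
Proof.
move=> lM; rewrite /determinant; apply: loclip_sum => s; apply: loclipM.
  exact: loclip_cst.
exact: loclip_prod.
Qed.

Lemma loclip_adj n (M : V -> 'M[R]_n) i j : (forall i j, loclip (fun w => M w i j)) ->
  loclip (fun w => (\adj (M w)) i j).
Proof.
move=> lM; under eq_fun do rewrite mxE /cofactor; apply: loclipM; first exact: loclip_cst.
by apply: loclip_det => k l; under eq_fun do rewrite !mxE; exact: lM.
Qed.

(** Gives one constant and one radius for all states, and the same constant for the bound and for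
    the Lipschitz estimate. *)
Lemma loclip_fin_uniform (I : finType) (f : I -> V -> R) : (forall i, loclip (f i)) ->
  exists C rho, [/\ 0 <= C, 0 < rho,
    forall i w, `|w - v| <= rho -> `|f i w| <= C &
    forall i w w', `|w - v| <= rho -> `|w' - v| <= rho -> `|f i w - f i w'| <= C * `|w - w'|].
Proof.
move=> lf.
suff [C [r [C0 r0 Hb Hl]]] : exists C rho, [/\ 0 <= C, 0 < rho,
    forall i w, i \in enum I -> `|w - v| <= rho -> `|f i w| <= C &
    forall i w w', i \in enum I -> `|w - v| <= rho -> `|w' - v| <= rho ->
      `|f i w - f i w'| <= C * `|w - w'|].
  by exists C, r; split=> // *; [apply: Hb|apply: Hl]; rewrite ?mem_enum.
elim: (enum I) => [|i s [C [r [C0 r0 Hb Hl]]]]; first by exists 0, 1; split.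
have [B [t [B0 t0 Bf]]] := loclip_bounded (lf i).
have [C' [r' [C'0 r'0 H']]] := lf i.
exists (C + B + C'), (Num.min r (Num.min t r')); split.
- by rewrite !addr_ge0.
- by rewrite !lt_min r0 t0.
- move=> k w; rewrite inE !le_min => /orP[/eqP -> /and3P[_ wt _]|ks /and3P[wr _ _]].
    by rewrite (le_trans (Bf _ wt))//; lra.
  by rewrite (le_trans (Hb _ _ ks wr))//; lra.
- move=> k w w'; rewrite inE !le_min => /orP[/eqP ->|ks] /and3P[wr _ wr'] /and3P[w'r _ w'r'].
    by rewrite (le_trans (H' _ _ wr' w'r'))// ler_wpM2r//; lra.
  by rewrite (le_trans (Hl _ _ _ ks wr w'r))// ler_wpM2r//; lra.
Qed.

End LocallyLipschitz.

(** * Solving the Poisson equation of the reversible walk *)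

Section Poisson.
Variables (R : realType) (N : nat) (A : 'M[R]_N).
Hypothesis Asym : A^T = A.
Hypothesis Anneg : forall i j, 0 <= A i j.
Hypothesis Apos : forall i j, i != j -> 0 < A i j.

Let Asymij i j : A i j = A j i.
Proof. by rewrite -{1}Asym mxE. Qed.

(* With K(i,j) = A_ij p_j / (A p)_i the transition matrix, this is diag(A p) (I - K)
   perturbed by a rank-one matrix which makes it invertible. *)
Definition poisson_mx (p : 'I_N -> R) : 'M[R]_N := \matrix_(i, j)
  ((\sum_k A i k * p k) *+ (i == j) - A i j * p j +
   (\sum_k A i k * p k) * p j * (\sum_k A j k * p k)).

Variable p : 'I_N -> R.
Hypothesis p_ge0 : forall i, 0 <= p i.
Let q i := \sum_k A i k * p k.
Hypothesis q_gt0 : forall i, 0 < q i.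

Let H := \sum_i p i * q i.

Lemma poisson_mx_mul (x : 'I_N -> R) i :
  \sum_j poisson_mx p i j * x j = q i * x i - \sum_j A i j * p j * x j + q i * \sum_j p j * q j * x j.
Proof.
under eq_bigr do rewrite mxE -!/(q _) !mulrDl mulNr.
rewrite !big_split/= sumrN; congr (_ - _ + _).
  rewrite (bigD1 i)//= eqxx mulr1n big1 ?addr0// => j ji.
  by rewrite eq_sym (negPf ji) mulr0n mul0r.
by rewrite mulr_sumr; apply: eq_bigr => j _; rewrite !mulrA.
Qed.

(** The weights [p i * q i] are reversible, so summing against [p] kills the part [diag(q) (I - K)]
    and leaves the rank-one part. *)
Lemma sum_poisson_mx_mul (x : 'I_N -> R) :
  \sum_i p i * (\sum_j poisson_mx p i j * x j) = H * \sum_j p j * q j * x j.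
Proof.
under eq_bigr do rewrite poisson_mx_mul.
have E : \sum_i p i * \sum_j A i j * p j * x j = \sum_i p i * q i * x i.
  under eq_bigr do rewrite mulr_sumr.
  rewrite exchange_big; apply: eq_bigr => j _.
  rewrite /q mulr_sumr mulr_suml; apply: eq_bigr => i _; rewrite (Asymij i j); ring.
under eq_bigr do rewrite mulrDr mulrBr.
rewrite big_split/= sumrB E [X in X - _](_ : _ = \sum_i p i * q i * x i) ?subrr ?add0r.
  by rewrite /H mulr_suml; apply: eq_bigr => i _; rewrite mulrA.
by apply: eq_bigr => i _; rewrite mulrA.
Qed.

Hypothesis H_gt0 : 0 < H.

(** A kernel vector has mean 0 under the weights [p i * q i], hence is harmonic. Its Dirichlet form
    then vanishes, which makes it constant where [p] is nonzero; harmonicity makes it constant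
    everywhere, and the zero mean makes it 0. *)
Lemma poisson_mx_unit : poisson_mx p \in unitmx.
Proof.
rewrite -unitmx_tr -row_free_unit; apply: inj_row_free => u uM.
pose x j := u ord0 j.
have E i : \sum_j poisson_mx p i j * x j = 0.
  have := congr1 (fun z : 'rV_N => z ord0 i) uM; rewrite [RHS]mxE [LHS]mxE => e; rewrite -[RHS]e.
  by apply: eq_bigr => j _; rewrite [(poisson_mx p)^T j i]mxE mulrC.
have s0 : \sum_j p j * q j * x j = 0.
  apply: (mulfI (lt0r_neq0 H_gt0)); rewrite mulr0 -sum_poisson_mx_mul.
  by rewrite big1// => i _; rewrite E mulr0.
have harm i : q i * x i = \sum_j A i j * p j * x j.
  by have := E i; rewrite poisson_mx_mul s0 mulr0 addr0 => /eqP; rewrite subr_eq0 => /eqP.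
have T_ge0 i j : 0 <= A i j * p i * p j * (x i - x j) ^+ 2.
  by apply: mulr_ge0 (sqr_ge0 _); rewrite !mulr_ge0.
(* the Dirichlet form of a harmonic function vanishes *)
have D0 : \sum_i \sum_j A i j * p i * p j * (x i - x j) ^+ 2 = 0.
  have E1 : \sum_i \sum_j A i j * p i * p j * x i ^+ 2 = \sum_i p i * x i * (q i * x i).
    apply: eq_bigr => i _; rewrite /q mulr_suml mulr_sumr; apply: eq_bigr => j _; ring.
  have E2 : \sum_i \sum_j A i j * p i * p j * x j ^+ 2 = \sum_i p i * x i * (q i * x i).
    rewrite -E1 exchange_big; apply: eq_bigr => i _; apply: eq_bigr => j _.
    rewrite Asymij; ring.
  have E3 : \sum_i \sum_j A i j * p i * p j * (x i * x j) = \sum_i p i * x i * (q i * x i).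
    apply: eq_bigr => i _; rewrite harm mulr_sumr; apply: eq_bigr => j _; ring.
  transitivity (\sum_i (\sum_j A i j * p i * p j * x i ^+ 2 + \sum_j A i j * p i * p j * x j ^+ 2 -
    (\sum_j A i j * p i * p j * (x i * x j)) * 2)).
    apply: eq_bigr => i _; rewrite mulr_suml -big_split/= -sumrB.
    apply: eq_bigr => j _; ring.
  rewrite sumrB big_split/= E1 E2 -mulr_suml E3; ring.
have /existsP[s ps0] : [exists s, p s != 0].
  rewrite -negb_forall; apply: contraL H_gt0 => /forallP p0.
  by rewrite /H big1 ?ltxx// => i _; rewrite (eqP (p0 i)) mul0r.
have const j : p j * x j = p j * x s.
  have [->//|js] := eqVneq j s; have [->|pj0] := eqVneq (p j) 0; first by rewrite !mul0r.
  move/eqP: D0; rewrite psumr_eq0; last by move=> k _; rewrite sumr_ge0.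
  move/allP => /(_ j (mem_index_enum _))/=; rewrite psumr_eq0//.
  move/allP => /(_ s (mem_index_enum _))/=.
  rewrite !mulf_eq0 (gt_eqF (Apos js)) (negPf pj0) (negPf ps0)/= orbb subr_eq0.
  by move=> /eqP ->.
(* The Dirichlet form says nothing about states with [p i = 0]; there the harmonic equation with
   [q i > 0] carries over the constant. *)
have xs i : x i = x s.
  apply: (mulfI (lt0r_neq0 (q_gt0 i))); rewrite harm /q mulr_suml.
  by apply: eq_bigr => j _; rewrite -!mulrA const.
have xs0 : x s = 0.
  apply: (mulfI (lt0r_neq0 H_gt0)); rewrite mulr0 -[RHS]s0 mulr_suml.
  by apply: eq_bigr => j _; rewrite xs.
by apply/rowP => i; rewrite mxE -xs0 -(xs i).
Qed.

(** The inverse of [poisson_mx] applied to [diag(q)], written with determinant and adjugate so that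
    regularity in [p] can be read off entrywise. *)
Definition poisson_sol : 'M[R]_N := \matrix_(i, k)
  ((\det (poisson_mx p))^-1 * (\adj (poisson_mx p)) i k * q k).

(** Divided by [q i], this is [K Q = Q - I + Pi], all rows of [Pi] being the stationary law
    [p k * q k / H]. The stationary law appears as the value of the rank-one term, found by summing
    against [p]. *)
Lemma poisson_solE i k : \sum_j A i j * p j * poisson_sol j k =
  q i * (poisson_sol i k - (i == k)%:R + p k * q k / H).
Proof.
pose Q j := poisson_sol j k.
have E l : \sum_j poisson_mx p l j * Q j = (l == k)%:R * q k.
  have := congr1 (fun M : 'M[R]_N => M l k) (mulmxV poisson_mx_unit).
  rewrite [LHS]mxE [RHS]mxE => <-; rewrite mulr_suml; apply: eq_bigr => j _.
  have I : invmx (poisson_mx p) j k = (\det (poisson_mx p))^-1 * (\adj (poisson_mx p)) j k.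
    by rewrite /invmx poisson_mx_unit mxE.
  by rewrite I /Q [poisson_sol j k]mxE mulrA.
have S : \sum_j p j * q j * Q j = p k * q k / H.
  apply: (mulfI (lt0r_neq0 H_gt0)); rewrite mulrCA divff ?lt0r_neq0// mulr1 -sum_poisson_mx_mul.
  rewrite (bigD1 k)//= E eqxx mul1r big1 ?addr0// => j jk.
  by rewrite E (negPf jk) mul0r mulr0.
have := E i; rewrite poisson_mx_mul S.
have -> : (i == k)%:R * q k = q i * (i == k)%:R.
  by case: eqVneq => [->|_]; rewrite ?mul1r ?mulr1// mul0r mulr0.
by move=> e; rewrite mulrDr mulrBr -e /Q; ring.
Qed.
End Poisson.

Lemma loclip_coord (R : realType) (N : nat) (v : 'rV[R]_N) i :
  loclip v (fun w : 'rV[R]_N => w ord0 i : R).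
Proof.
exists 1, 1; split=> // w w' _ _; rewrite mul1r.
by have := normr_coord_le (w - w') ord0 i; rewrite !mxE.
Qed.

Lemma loclip_vpow (R : realType) (N : nat) (alpha : R) (v : 'rV[R]_N) i : 1 < alpha ->
  loclip v (fun w => vpow alpha w ord0 i).
Proof.
move=> a1; pose M := `|v| + 1; have M0 : 0 <= M by rewrite addr_ge0.
exists (alpha * M `^ (alpha - 1)), 1; split=> //.
  by rewrite mulr_ge0 ?powR_ge0// ltW// (lt_trans _ a1).
have wM w : `|w - v| <= 1 -> `|w ord0 i| <= M.
  move=> wv; rewrite (le_trans (normr_coord_le _ _ _))// -(subrK v w) addrC.
  by rewrite (le_trans (ler_normD _ _))// lerD2l.
move=> w w' wv w'v; rewrite !mxE.
rewrite (le_trans (abs_powR_lipschitz a1 M0 (wM _ wv) (wM _ w'v)))// ler_wpM2l//.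
  by rewrite mulr_ge0 ?powR_ge0// ltW// (lt_trans _ a1).
by have := normr_coord_le (w - w') ord0 i; rewrite !mxE.
Qed.

(** * The corrector and the drift of the squared distance *)

Section Lyapunov.
Variables (R : realType) (N : nat) (alpha : R) (A : 'M[R]_N).
Hypothesis HN : (2 <= N)%N.
Hypothesis alpha_gt1 : 1 < alpha.
Hypothesis Asym : A^T = A.
Hypothesis Anneg : forall i j, 0 <= A i j.
Hypothesis Apos : forall i j, i != j -> 0 < A i j.

Let p (w : 'rV[R]_N) i := vpow alpha w ord0 i.
Let q := Avpow alpha A.

Lemma vpow_ge0 (w : 'rV[R]_N) i : 0 <= vpow alpha w ord0 i.
Proof. by rewrite mxE powR_ge0. Qed.

Lemma vpow_gt0 (w : 'rV[R]_N) i : 0 < w ord0 i -> 0 < vpow alpha w ord0 i.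
Proof. by move=> wi; rewrite mxE powR_gt0// normr_gt0 gt_eqF. Qed.

Lemma Avpow_gt0 (w : 'rV[R]_N) i : (forall k, 0 < w ord0 k) -> 0 < Avpow alpha A w i.
Proof.
move=> w0.
(* Diagonal entries of [A] may vanish, so a state other than [i] is needed: state 1 if [i] is 0, and
   state 0 otherwise. *)
have [j ij] : exists j : 'I_N, i != j.
  have [i0|i0] := eqVneq (nat_of_ord i) 0%N.
    by exists (Ordinal HN); rewrite -val_eqE/= i0.
  by exists (Ordinal (leq_trans (isT : 0 < 2)%N HN)); rewrite -val_eqE.
rewrite /Avpow (bigD1 j)//= ltr_pwDl//.
  by rewrite mulr_gt0 ?Apos ?vpow_gt0.
by rewrite sumr_ge0// => k _; rewrite mulr_ge0 ?vpow_ge0.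
Qed.

Lemma sum_vpow_Avpow_gt0 (w : 'rV[R]_N) : (forall k, 0 < w ord0 k) ->
  0 < \sum_i vpow alpha w ord0 i * Avpow alpha A w i.
Proof.
move=> w0; rewrite (bigD1 (Ordinal HN))//= ltr_pwDl//.
  by rewrite mulr_gt0 ?vpow_gt0 ?Avpow_gt0.
by rewrite sumr_ge0// => k _; rewrite mulr_ge0 ?vpow_ge0// ltW// Avpow_gt0.
Qed.

Variable v : 'rV[R]_N.
Hypothesis v_eq : equilibrium alpha A v.

Lemma equilibrium_ge0 i : 0 <= v ord0 i.
Proof. by case: v_eq => -[]. Qed.

Lemma equilibrium_sum : \sum_i v ord0 i = 1.
Proof. by case: v_eq => -[_ []]. Qed.

Lemma equilibrium_le1 i : v ord0 i <= 1.
Proof.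
rewrite -equilibrium_sum (bigD1 i)//= lerDl sumr_ge0// => j _.
exact: equilibrium_ge0.
Qed.

Lemma equilibrium_pi : pi_map alpha A v = v.
Proof.
case: v_eq => _; rewrite /Ffield => /eqP; rewrite addrC subr_eq0 => /eqP; exact.
Qed.

(** If [Hfun] vanished, the convention for division by 0 would give [pi_map v = 0], while
    [pi_map v = v] has total mass 1. *)
Lemma equilibrium_Hfun_gt0 : 0 < Hfun alpha A v.
Proof.
rewrite lt_neqAle; apply/andP; split; last first.
  by rewrite /Hfun; do 2 (rewrite sumr_ge0// => ? _); rewrite !mulr_ge0 ?vpow_ge0.
apply/eqP => H0; have := equilibrium_sum; rewrite -equilibrium_pi.
rewrite big1 => [/esym/eqP|i _]; first by rewrite oner_eq0.
by rewrite mxE -H0 invr0 mulr0.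
Qed.

(** Coordinates of [v] may be 0 here. If [q v i = 0], then [v] vanishes off [i], and every term
    [p k * q k] of [Hfun] is 0. *)
Lemma equilibrium_Avpow_gt0 i : 0 < q v i.
Proof.
have q0 k : 0 <= q v k by rewrite sumr_ge0// => j _; rewrite mulr_ge0 ?vpow_ge0.
have [qi0|qi0] := eqVneq (q v i) 0; last by rewrite lt_neqAle eq_sym qi0 q0.
have off j : j != i -> p v j = 0.
  move=> ji; move/eqP: qi0; rewrite psumr_eq0; last by move=> k _; rewrite mulr_ge0 ?vpow_ge0.
  move/allP => /(_ j (mem_index_enum _))/=; rewrite mulf_eq0 (gt_eqF (Apos _)) 1?eq_sym//= => /eqP; exact.
have := equilibrium_Hfun_gt0; rewrite HfunE big1 ?ltxx// => k _.
have [->|ki] := eqVneq k i; first by rewrite -/(q v i) qi0 mulr0.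
by rewrite -/(p v k) off// mul0r.
Qed.

Lemma equilibrium_piE k : p v k * q v k / \sum_i p v i * q v i = v ord0 k.
Proof. by rewrite -[in RHS]equilibrium_pi mxE HfunE. Qed.

(** Poisson equation of the walk frozen at [w = v], whose stationary law is [v]; it drives the
    deterministic path below. *)
Lemma equilibrium_poisson : exists Q : 'I_N -> 'I_N -> R, forall i k,
  \sum_j A i j * vpow alpha v ord0 j * Q j k = Avpow alpha A v i * (Q i k - (i == k)%:R + v ord0 k).
Proof.
exists (fun j k => poisson_sol A (p v) j k) => i k.
rewrite (poisson_solE Asym Anneg Apos (vpow_ge0 v) equilibrium_Avpow_gt0); last first.
  by have := equilibrium_Hfun_gt0; rewrite HfunE.
by rewrite equilibrium_piE.
Qed.

(** For [f j = weight (v j) * (w j - v j)], the pairing of [w - v] with the basis vector of [j],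
    this is [G - f] where [G] solves the Poisson equation of [f]. Hence [K (f + corrector)] is
    [corrector] plus the stationary mean of [f]. *)
Definition corrector (w : 'rV[R]_N) i := \sum_k weight (v ord0 k) * (w ord0 k - v ord0 k) *
  (poisson_sol A (fun j => vpow alpha w ord0 j) i k - (i == k)%:R).

(** By Cramer's rule the only denominator is the determinant of [poisson_mx], which is nonzero at
    [v]. *)
Lemma loclip_corrector i : loclip v (fun w => corrector w i).
Proof.
have lp j : loclip v (fun w => p w j) by exact: loclip_vpow.
have lq j : loclip v (fun w => q w j).
  by apply: loclip_sum => k; apply: loclipM; [exact: loclip_cst|exact: lp].
have lM j k : loclip v (fun w => poisson_mx A (p w) j k).
  under eq_fun do rewrite mxE mulrb -mulNr.
  apply: loclipD; last first.
    by apply: loclipM; [apply: loclipM; [exact: lq|exact: lp]|exact: lq].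
  apply: loclipD; last by apply: loclipM; [exact: loclip_cst|exact: lp].
  case: eqVneq => _; [exact: lq|exact: loclip_cst].
apply: loclip_sum => k; apply: loclipM.
  apply: loclipM; [exact: loclip_cst|apply: loclipD; [exact: loclip_coord|exact: loclip_cst]].
apply: loclipD; last exact: loclip_cst.
under eq_fun do rewrite mxE.
apply: loclipM; last exact: lq.
apply: loclipM; last exact: loclip_adj.
apply: loclip_inv; last exact: loclip_det.
rewrite -unitfE -unitmxE.
apply: (poisson_mx_unit Asym Anneg Apos (vpow_ge0 v) equilibrium_Avpow_gt0).
by have := equilibrium_Hfun_gt0; rewrite HfunE.
Qed.

Lemma corrector_poisson (w : 'rV[R]_N) i : (forall k, 0 < w ord0 k) ->
  \sum_j A i j * p w j * (weight (v ord0 j) * (w ord0 j - v ord0 j) + corrector w j) =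
  q w i * (corrector w i + wprod v (w - v) (pi_map alpha A w)).
Proof.
move=> w0; set Q := poisson_sol A (fun j => vpow alpha w ord0 j).
pose b k := weight (v ord0 k) * (w ord0 k - v ord0 k).
have E j : weight (v ord0 j) * (w ord0 j - v ord0 j) + corrector w j = \sum_k b k * Q j k.
  rewrite /corrector -/Q.
  under [X in _ + X]eq_bigr do rewrite mulrBr -/(b _).
  have D : \sum_k b k * (j == k)%:R = b j.
    rewrite (bigD1 j)//= eqxx mulr1 big1 ?addr0// => k kj.
    by rewrite eq_sym (negPf kj) mulr0.
  by rewrite sumrB D -/(b j) subrKC.
under eq_bigr do rewrite E mulr_sumr.
rewrite exchange_big/= /wprod /corrector -big_split/= mulr_sumr.
apply: eq_bigr => k _; rewrite -/(b k) -/Q.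
under eq_bigr do rewrite mulrCA.
rewrite -mulr_sumr (poisson_solE Asym Anneg Apos (vpow_ge0 w)
  (fun i => Avpow_gt0 i w0) (sum_vpow_Avpow_gt0 w0)).
rewrite [pi_map _ _ _ _ _]mxE [(w - v) _ _]mxE [(- v) _ _]mxE -/(b k) HfunE -/Q.
by rewrite mulrCA -mulrDr.
Qed.

Hypothesis stable : forall re im, DF_eigenvalue alpha A v re im -> re < 0.

(** Everything the supermartingale needs from the spectral and Poisson analysis, with [h] the
    corrector. The drift is stated multiplied by [Avpow], the normalisation of the kernel. *)
Lemma lyapunov : exists (c rho C : R) (h : 'rV[R]_N -> 'I_N -> R), [/\ [/\ 0 < c, 0 < rho & 0 <= C],
  forall i (w : 'rV[R]_N), `|w - v| <= rho -> `|h w i| <= C,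
  forall i (w w' : 'rV[R]_N), `|w - v| <= rho -> `|w' - v| <= rho -> `|h w i - h w' i| <= C * `|w - w'| &
  forall i (w : 'rV[R]_N), (forall k, 0 < w ord0 k) -> \sum_k w ord0 k = 1 -> `|w - v| <= rho ->
    \sum_j A i j * vpow alpha w ord0 j * (weight (v ord0 j) * (w ord0 j - v ord0 j) + h w j) <=
    Avpow alpha A w i * (h w i + wprod v (w - v) w - c * wprod v (w - v) (w - v))].
Proof.
have [c [r1 [c0 r10 drift]]] := drift_near alpha_gt1 Asym equilibrium_ge0 equilibrium_le1
  (lt0r_neq0 equilibrium_Hfun_gt0) stable v_eq.2.
have [C [r2 [C0 r20 hb hl]]] := loclip_fin_uniform loclip_corrector.
exists c, (Num.min r1 r2), C, corrector; split.
- by rewrite lt_min r10.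
- by move=> i w; rewrite le_min => /andP[_]; exact: hb.
- by move=> i w w'; rewrite !le_min => /andP[_ ?] /andP[_ ?]; exact: hl.
move=> i w w0 w1; rewrite le_min => /andP[wr _].
rewrite corrector_poisson// ler_wpM2l// ?(ltW (Avpow_gt0 _ _))// -addrA lerD2l.
have T : tangent (w - v).
  rewrite /tangent; under eq_bigr do rewrite !mxE.
  by rewrite sumrB w1 equilibrium_sum subrr.
have := drift _ T wr.
have -> : pi_map alpha A w = 1 *: Ffield alpha A w + w by rewrite scale1r /Ffield addrAC addNr add0r.
rewrite wprodDr; lra.
Qed.

End Lyapunov.

(** * The supermartingale *)

Section Paths.
Variables (R : realType) (N : nat) (alpha : R) (A : 'M[R]_N).
Implicit Types (x : nat -> 'I_N) (n : nat).

(** Includes the initial weights 1, so all coordinates are positive, the total is exactly 1, and the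
    kernel is a function of this vector and the current state. *)
Definition wocc x n : 'rV[R]_N := \row_i ((1 + (Zcount x n i)%:R) / (n.+1 + N)%:R).

Definition gain n : R := (n.+2 + N)%:R^-1.

(** One-step continuation of a path known up to time [n]; values after [n + 1] are filler. *)
Definition extend x n (j : 'I_N) : nat -> 'I_N := fun k => if (k <= n)%N then x k else j.

Lemma extend_le x n j k : (k <= n)%N -> extend x n j k = x k.
Proof. by rewrite /extend => ->. Qed.

Lemma extend_last x n j : extend x n j n.+1 = j.
Proof. by rewrite /extend ltnn. Qed.

Lemma eq_Zcount x y n i : (forall k, (k <= n)%N -> x k = y k) -> Zcount x n i = Zcount y n i.
Proof. by move=> xy; apply: eq_bigr => k _; rewrite xy// -ltnS. Qed.

Lemma eq_wocc x y n : (forall k, (k <= n)%N -> x k = y k) -> wocc x n = wocc y n.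
Proof. by move=> xy; apply/rowP => i; rewrite !mxE (eq_Zcount _ xy). Qed.

Lemma ZcountS x n i : Zcount x n.+1 i = (Zcount x n i + (x n.+1 == i))%N.
Proof. by rewrite /Zcount big_ord_recr. Qed.

Lemma sum_Zcount x n : (\sum_i Zcount x n i = n.+1)%N.
Proof.
rewrite /Zcount exchange_big/= (eq_bigr (fun=> 1%N)) ?sum1_card ?card_ord// => l _.
by rewrite (bigD1 (x l))//= eqxx big1// => i; rewrite eq_sym => /negPf ->.
Qed.

Lemma gain_gt0 n : 0 < gain n.
Proof. by rewrite invr_gt0 ltr0n. Qed.

Lemma gain_lt n : gain n.+1 < gain n.
Proof. by rewrite ltf_pV2 ?posrE ?ltr0n// ltr_nat. Qed.

Lemma gain_sub n : gain n - gain n.+1 <= gain n ^+ 2.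
Proof.
have g0 := gain_gt0 n; have g1 := gain_gt0 n.+1.
have -> : gain n - gain n.+1 = gain n * gain n.+1.
  rewrite /gain !addSn -[(n + N).+3%:R]natr1.
  have t0 : 0 < (n + N).+2%:R :> R by rewrite ltr0n.
  by move: t0; move: _%:R => t t0; field; rewrite !lt0r_neq0 ?addr_gt0.
by rewrite expr2 ler_pM2l// ltW// gain_lt.
Qed.

Lemma wocc_gt0 x n i : 0 < wocc x n ord0 i.
Proof. by rewrite mxE divr_gt0 ?ltr0n// ltr_pwDl. Qed.

Lemma sum_wocc x n : \sum_i wocc x n ord0 i = 1.
Proof.
under eq_bigr do rewrite mxE.
rewrite -mulr_suml big_split/= sumr_const card_ord -natr_sum sum_Zcount.
by rewrite -natrD addnC divff// pnatr_eq0.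
Qed.

Lemma wocc_le1 x n i : wocc x n ord0 i <= 1.
Proof.
rewrite -(sum_wocc x n) (bigD1 i)//= lerDl sumr_ge0// => j _.
exact/ltW/wocc_gt0.
Qed.

Lemma wocc_extend x n j :
  wocc (extend x n j) n.+1 = wocc x n + gain n *: (delta_mx ord0 j - wocc x n).
Proof.
apply/rowP => i; rewrite !mxE ZcountS extend_last eqxx/= (eq_sym i).
rewrite (@eq_Zcount _ x); last by move=> k; exact: extend_le.
rewrite /gain natrD !addSn -[(n + N).+2%:R]natr1.
have t0 : 0 < (n + N).+1%:R :> R by rewrite ltr0n.
move: t0; move: (n + N).+1%:R => t t0; move: (Zcount x n i)%:R (_ == _)%:R => z d.
by field; rewrite !lt0r_neq0 ?addr_gt0.
Qed.

(** The common factor [(n + 1 + N)^alpha] cancels between numerator and denominator. *)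
Lemma vrrw_kernelE x n j : vrrw_kernel alpha A x n j =
  A (x n) j * vpow alpha (wocc x n) ord0 j / Avpow alpha A (wocc x n) (x n).
Proof.
have E k : (1 + (Zcount x n k)%:R) `^ alpha =
    vpow alpha (wocc x n) ord0 k * (n.+1 + N)%:R `^ alpha.
  rewrite mxE (gtr0_norm (wocc_gt0 x n k)) -powRM ?ler0n ?(ltW (wocc_gt0 _ _ _))//.
  by rewrite mxE divfK// pnatr_eq0.
have c0 : (n.+1 + N)%:R `^ alpha != 0 :> R by rewrite gt_eqF// powR_gt0// ltr0n.
rewrite /vrrw_kernel E; under eq_bigr do rewrite E mulrA.
by rewrite -mulr_suml mulrA -mulf_div divff// mulr1.
Qed.

End Paths.

(** * Drift estimates and the supermartingale in a ball around the equilibrium *)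

Section Tube.
Variables (R : realType) (N : nat) (alpha : R) (A : 'M[R]_N).
Hypothesis HN : (2 <= N)%N.
Hypothesis Anneg : forall i j, 0 <= A i j.
Hypothesis Apos : forall i j, i != j -> 0 < A i j.
Variable v : 'rV[R]_N.
Hypothesis v_ge0 : forall i, 0 <= v ord0 i.
Hypothesis v_le1 : forall i, v ord0 i <= 1.
Variables (c rho C : R) (h : 'rV[R]_N -> 'I_N -> R).
Hypotheses (c_gt0 : 0 < c) (rho_gt0 : 0 < rho) (C_ge0 : 0 <= C).
Hypothesis h_bounded : forall i (w : 'rV[R]_N), `|w - v| <= rho -> `|h w i| <= C.
Hypothesis h_lipschitz : forall i (w w' : 'rV[R]_N), `|w - v| <= rho -> `|w' - v| <= rho ->
  `|h w i - h w' i| <= C * `|w - w'|.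
Hypothesis h_drift : forall i (w : 'rV[R]_N), (forall k, 0 < w ord0 k) ->
  \sum_k w ord0 k = 1 -> `|w - v| <= rho ->
  \sum_j A i j * vpow alpha w ord0 j * (weight (v ord0 j) * (w ord0 j - v ord0 j) + h w j) <=
  Avpow alpha A w i * (h w i + wprod v (w - v) w - c * wprod v (w - v) (w - v)).

Let V (w : 'rV[R]_N) := wprod v (w - v) (w - v).
Let g := @gain R N.
Let M := \sum_i weight (v ord0 i).

Let M_ge0 : 0 <= M.
Proof. by rewrite sumr_ge0// => i _; exact/ltW/weight_gt0. Qed.

(** The factor 2 matches the cross term [2 * gain * wprod (w - v) e] in the expansion of the square
    after a step. *)
Definition lyap n (w : 'rV[R]_N) i := wprod v (w - v) (w - v) + 2 * gain R N n * h w i.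

Lemma vrrw_kernel_ge0 x n j : 0 <= vrrw_kernel alpha A x n j.
Proof.
rewrite vrrw_kernelE divr_ge0 ?mulr_ge0 ?vpow_ge0// ltW// Avpow_gt0// => k.
exact: wocc_gt0.
Qed.

Lemma sum_vrrw_kernel x n : \sum_j vrrw_kernel alpha A x n j = 1.
Proof.
under eq_bigr do rewrite vrrw_kernelE.
rewrite -mulr_suml divff// gt_eqF// Avpow_gt0// => k; exact: wocc_gt0.
Qed.

Lemma step_norm_le1 x n j : `|(delta_mx ord0 j : 'rV[R]_N) - wocc R x n| <= 1.
Proof.
apply: mx_norm_le => // i k; have := wocc_gt0 R x n k; have := wocc_le1 R x n k.
rewrite (ord1 i); move: (wocc R x n) => w; rewrite !mxE/= ler_norml.
by case: eqVneq => _ /=; lra.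
Qed.

(** The quadratic term of the expansion costs [M g^2]. Replacing the new correction by the old one
    costs [4 C g^2], half from the Lipschitz bound in [w] and half from the decrease of the gain.
    The radius [rho / 2] keeps both ends of the step within [rho]. *)
Lemma lyap_step x n j : `|wocc R x n - v| <= rho / 2 -> g n <= rho / 2 ->
  let w := wocc R x n in
  lyap n.+1 (wocc R (extend x n j) n.+1) j <=
  V w + 2 * g n * (weight (v ord0 j) * (w ord0 j - v ord0 j) + h w j - wprod v (w - v) w) +
  (M + 4 * C) * g n ^+ 2.
Proof.
move=> wr gr; cbv zeta; set w := wocc R x n; rewrite /lyap wocc_extend -/w -/(g n) -/(g n.+1).
set e := delta_mx ord0 j - w; set w' := w + _.
have g0 : 0 < g n := gain_gt0 R N n.
have g10 : 0 < g n.+1 := gain_gt0 R N n.+1.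
have e1 : `|e| <= 1 by exact: step_norm_le1.
have ww' : `|w' - w| <= g n.
  by rewrite /w' addrC addKr normrZ (gtr0_norm g0) -[leRHS]mulr1 ler_wpM2l// ltW.
have w'r : `|w' - v| <= rho.
  rewrite -(subrK w w') -addrA (le_trans (ler_normD _ _))// [leRHS]splitr lerD//.
  exact: le_trans gr.
have wr' : `|w - v| <= rho by rewrite (le_trans wr)// ler_pdivrMr// ler_peMr ?ler1n// ltW.
have EV : wprod v (w' - v) (w' - v) = V w + 2 * g n * wprod v (w - v) e + g n ^+ 2 * wprod v e e.
  have -> : w' - v = g n *: e + (w - v) by rewrite /w' addrAC addrC.
  rewrite wprodDl !wprodDr (wprodC v e) /V; ring.
have Ee : wprod v (w - v) e = weight (v ord0 j) * (w ord0 j - v ord0 j) - wprod v (w - v) w.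
  have -> : e = (-1) *: w + delta_mx ord0 j by rewrite scaleN1r addrC.
  rewrite wprodDr mulN1r addrC; congr (_ - _).
  rewrite /wprod (bigD1 j)//= big1 ?addr0; first by rewrite !mxE !eqxx mulr1.
  by move=> k kj; rewrite [delta_mx _ _ _ _]mxE (negPf kj) andbF mulr0.
have Hee : wprod v e e <= M.
  rewrite (le_trans (ler_norm _))// (le_trans (normr_wprod_le v_ge0 _ _))//.
  by rewrite -mulrA -[leRHS]mulr1 ler_wpM2l// -expr2 expr_le1.
have Hh : g n.+1 * h w' j <= g n * h w j + 2 * C * g n ^+ 2.
  have h1 : g n * (h w' j - h w j) <= C * g n ^+ 2.
    have : h w' j - h w j <= C * g n.
      rewrite (le_trans (ler_norm _))// (le_trans (h_lipschitz _ w'r wr'))//.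
      by rewrite ler_wpM2l.
    by rewrite -(ler_pM2l g0); lra.
  have h2 : (g n.+1 - g n) * h w' j <= C * g n ^+ 2.
    rewrite (le_trans (ler_norm _))// normrM mulrC ler_pM ?h_bounded//.
    rewrite distrC ger0_norm ?gain_sub// subr_ge0 ltW//; exact: gain_lt.
  lra.
have : g n ^+ 2 * wprod v e e <= M * g n ^+ 2 by rewrite mulrC ler_wpM2r ?sqr_ge0.
rewrite EV Ee.
lra.
Qed.

(** On averaging [lyap_step], the Poisson property restores the correction at the current state, the
    terms [wprod v (w - v) w] cancel, and the contraction remains. *)
Lemma lyap_drift x n : `|wocc R x n - v| <= rho / 2 -> g n <= rho / 2 ->
  let w := wocc R x n in
  \sum_j vrrw_kernel alpha A x n j * lyap n.+1 (wocc R (extend x n j) n.+1) j <=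
  lyap n w (x n) - 2 * c * g n * V w + (M + 4 * C) * g n ^+ 2.
Proof.
move=> wr gr; cbv zeta; set w := wocc R x n; have g0 : 0 < g n := gain_gt0 R N n.
have wr' : `|w - v| <= rho by rewrite (le_trans wr)// ler_pdivrMr// ler_peMr ?ler1n// ltW.
have q0 : 0 < Avpow alpha A w (x n) by rewrite Avpow_gt0// => k; exact: wocc_gt0.
set b := fun j => weight (v ord0 j) * (w ord0 j - v ord0 j) + h w j.
have D : \sum_j vrrw_kernel alpha A x n j * b j <= h w (x n) + wprod v (w - v) w - c * V w.
  under eq_bigr do rewrite vrrw_kernelE -/w mulrAC.
  rewrite -mulr_suml ler_pdivrMr// [leRHS]mulrC.
  by apply: h_drift => //; [move=> k; exact: wocc_gt0|exact: sum_wocc].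
apply: (@le_trans _ _ (\sum_j vrrw_kernel alpha A x n j *
  (2 * g n * b j + (V w - 2 * g n * wprod v (w - v) w + (M + 4 * C) * g n ^+ 2)))).
  apply: ler_sum => j _; rewrite ler_wpM2l ?vrrw_kernel_ge0//.
  by have := lyap_step j wr gr; rewrite -/w /= -/(b j) => /le_trans; apply; lra.
under eq_bigr do rewrite mulrDr.
rewrite big_split/= -mulr_suml sum_vrrw_kernel mul1r.
under eq_bigr do rewrite mulrCA.
rewrite -mulr_sumr /lyap -/(V w) -/(g n).
have : 2 * g n * (\sum_j vrrw_kernel alpha A x n j * b j) <=
  2 * g n * (h w (x n) + wprod v (w - v) w - c * V w) by rewrite ler_pM2l// mulr_gt0.
lra.
Qed.

Variable n0 : nat.
Hypothesis gain_small : forall n, (n0 <= n)%N -> g n <= rho / 2.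

(** Starting at [c^-1] ensures [c * growth n >= 1], so the contraction of [lyap] can pay for the
    increments of this factor. *)
Definition growth n : R := c^-1 + \sum_(n0 <= k < n) gain R N k.

Let D := M + 6 * C.

Let D_ge0 : 0 <= D.
Proof. by rewrite addr_ge0// mulr_ge0. Qed.

(** The decreasing factor of the last term absorbs the second-order errors. In [D], [M + 4 * C] is
    the error of one step and [2 * C] bounds the correction met when [growth] increases. *)
Definition supermart n (w : 'rV[R]_N) i : R :=
  growth n * lyap n w i + D * (growth n + 2) / (n.+1 + N)%:R.

Lemma growth_ge n : c^-1 <= growth n.
Proof. by rewrite lerDl sumr_ge0// => k _; exact/ltW/gain_gt0. Qed.

Lemma growthS n : (n0 <= n)%N -> growth n.+1 = growth n + g n.
Proof. by move=> n0n; rewrite /growth big_nat_recr//= addrA. Qed.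

Lemma growth_gt0 n : 0 < growth n.
Proof. by rewrite (lt_le_trans _ (growth_ge n))// invr_gt0. Qed.

Let inv_time n : (n.+1 + N)%:R^-1 >= g n.
Proof. by rewrite lef_pV2 ?posrE ?ltr0n// ler_nat. Qed.

(** The correction is at least [- 2 * C * growth n * g n], covered by the last term since
    [D >= 2 * C]. This gives nonnegativity and a large value on leaving the tube. *)
Lemma supermart_ge n w i : `|w - v| <= rho -> growth n * V w <= supermart n w i.
Proof.
move=> wr; rewrite /supermart /lyap mulrDr -/(V w) -addrA lerDl.
have g0 : 0 < g n := gain_gt0 R N n.
have a0 := growth_gt0 n.
have : - C <= h w i by move: (h_bounded i wr); rewrite ler_norml => /andP[].
rewrite -(ler_pM2l (mulr_gt0 a0 g0)).
have : D * (growth n + 2) * g n <= D * (growth n + 2) / (n.+1 + N)%:R.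
  by rewrite ler_wpM2l// mulr_ge0// addr_ge0// ltW.
have : 2 * C * growth n * g n <= D * (growth n + 2) * g n.
  rewrite ler_wpM2r ?(ltW g0)//; apply: ler_pM; rewrite ?mulr_ge0 ?(ltW a0) ?lerDl//.
  by rewrite /D; move: M_ge0 C_ge0; lra.
rewrite -/(g n); lra.
Qed.

(** Increasing [growth] by [g n] costs about [g n * V w], paid by [2 * c * growth n * g n * V w]
    since [c * growth n >= 1]. What is left is of order [growth n * g n ^+ 2]. *)
Lemma supermart_drift x n : (n0 <= n)%N -> `|wocc R x n - v| <= rho / 2 ->
  \sum_j vrrw_kernel alpha A x n j * supermart n.+1 (wocc R (extend x n j) n.+1) j <=
  supermart n (wocc R x n) (x n).
Proof.
move=> n0n wr; set w := wocc R x n.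
have wr' : `|w - v| <= rho by rewrite (le_trans wr)// ler_pdivrMr// ler_peMr ?ler1n// ltW.
have g0 : 0 < g n := gain_gt0 R N n.
have g1 : g n <= 1 by rewrite invf_le1 ?ltr0n// ler1n.
have a0 := growth_gt0 n.
rewrite /supermart.
under eq_bigr do rewrite mulrDr.
rewrite big_split/= -[X in _ + X <= _]mulr_suml sum_vrrw_kernel mul1r.
under eq_bigr do rewrite mulrCA.
rewrite -mulr_sumr growthS//.
have := lyap_drift wr (gain_small n0n); rewrite -/w /=.
rewrite -(ler_pM2l (addr_gt0 a0 g0)) => L.
have V0 : 0 <= V w := wprod_ge0 v_ge0 _.
have lu : lyap n w (x n) <= V w + 2 * g n * C.
  rewrite /lyap lerD2l ler_pM2l ?mulr_gt0//.
  by rewrite (le_trans (ler_norm _))// h_bounded.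
set a := growth n in a0 L *; set U := lyap _ _ _ in L lu *.
have ca : 1 <= c * a by rewrite mulrC -ler_pdivrMr// mul1r growth_ge.
(* The decrease of the last term: the change of the denominator yields [a + 2], and the increase of
   [a] by [g n] takes back one unit. *)
have b1 : D * (a + 2) / (n.+1 + N)%:R - D * (a + g n + 2) / (n.+2 + N)%:R >= D * (a + 1) * g n ^+ 2.
  have Ig : g n + g n ^+ 2 <= (n.+1 + N)%:R^-1.
    have t0 : 0 < (n.+1 + N)%:R :> R by rewrite ltr0n.
    have Et : (n.+1 + N)%:R^-1 - g n = (n.+1 + N)%:R^-1 * g n.
      rewrite /g /gain !addSn -[(n + N).+2%:R]natr1.
      by move: t0; rewrite addSn; move: _%:R => t t0; field; rewrite !lt0r_neq0 ?addr_gt0.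
    have : g n ^+ 2 <= (n.+1 + N)%:R^-1 * g n by rewrite expr2 ler_wpM2r ?(ltW g0).
    lra.
  have : D * (a + 2) * (g n + g n ^+ 2) <= D * (a + 2) / (n.+1 + N)%:R.
    by rewrite ler_wpM2l// mulr_ge0// addr_ge0// ltW.
  rewrite -/(gain R N n) -/(g n); lra.
have L2 : (a + g n) * (U - 2 * c * g n * V w + (M + 4 * C) * g n ^+ 2) <= a * U + D * (a + 1) * g n ^+ 2.
  have h1 : g n * U <= g n * (V w + 2 * g n * C) by rewrite ler_pM2l.
  have h2 : g n * V w * 1 <= g n * V w * (c * a) by rewrite ler_wpM2l// mulr_ge0// ltW.
  have h3 : 0 <= c * g n * g n * V w by rewrite !mulr_ge0// ltW.
  have h4 : 0 <= (1 - g n) * (M + 4 * C) * g n ^+ 2.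
    have C'0 : 0 <= M + 4 * C by rewrite addr_ge0// mulr_ge0.
    by rewrite mulr_ge0 ?sqr_ge0// mulr_ge0// subr_ge0.
  have h5 : 0 <= C * a * g n ^+ 2 by rewrite !mulr_ge0 ?sqr_ge0// ltW.
  have h6 : 0 <= g n * V w by rewrite mulr_ge0// ltW.
  rewrite /D; lra.
rewrite -/(g n) in L *; lra.
Qed.

Lemma growth_start : growth n0 = c^-1.
Proof. by rewrite /growth big_geq// addr0. Qed.

(** The starting value is of order [1 / n0], hence below any fixed level for large [n0]. *)
Lemma supermart_start (w : 'rV[R]_N) i E : `|w - v| <= rho -> V w <= E / (n0.+1 + N)%:R ->
  supermart n0 w i <= (c^-1 * (E + 2 * C) + D * (c^-1 + 2)) / (n0.+1 + N)%:R.
Proof.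
move=> wr wE; rewrite /supermart growth_start [leRHS]mulrDl lerD2r -mulrA ler_wpM2l ?invr_ge0 ?(ltW c_gt0)//.
rewrite [leRHS]mulrDl lerD//.
have g0 : 0 < g n0 := gain_gt0 R N n0.
apply: (@le_trans _ _ (2 * g n0 * C)).
  by rewrite ler_pM2l ?mulr_gt0// (le_trans (ler_norm _))// h_bounded.
by rewrite -!mulrA ler_pM2l// mulrC ler_wpM2l.
Qed.

Lemma growth_ball n (w : 'rV[R]_N) : growth n * V w <= c^-1 * (rho / 2) ^+ 2 -> `|w - v| <= rho / 2.
Proof.
move=> H; rewrite -ler_sqr ?nnegrE ?divr_ge0// ?(ltW rho_gt0)//.
rewrite (le_trans (sqr_norm_le_wprod v_ge0 v_le1 _))//.
rewrite -(@ler_pM2l _ c^-1) ?invr_gt0// (le_trans _ H)// ler_wpM2r ?growth_ge//.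
exact: wprod_ge0.
Qed.

(** At its exit from the tube the walk may leave the ball of radius [rho / 2], but stays in that of
    radius [rho], where [supermart_ge] applies. *)
Lemma wocc_extend_ball x n j : (n0 <= n)%N -> `|wocc R x n - v| <= rho / 2 ->
  `|wocc R (extend x n j) n.+1 - v| <= rho.
Proof.
move=> n0n wr; rewrite wocc_extend addrAC.
rewrite (le_trans (ler_normD _ _))// [leRHS]splitr lerD// (le_trans _ (gain_small n0n))//.
have g0 : 0 < g n := gain_gt0 R N n.
rewrite normrZ (gtr0_norm g0) -[leRHS]mulr1 ler_wpM2l ?(ltW g0)//.
exact: step_norm_le1.
Qed.

End Tube.

(** * A deterministic path to the equilibrium *)

Section Greedy.
Variables (R : realType) (N : nat) (A : 'M[R]_N).
Hypothesis Anneg : forall i j, 0 <= A i j.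
Variable v : 'rV[R]_N.
Hypothesis v_ge0 : forall i, 0 <= v ord0 i.
Variables (p : 'I_N -> R) (Q : 'I_N -> 'I_N -> R).
Hypothesis p_ge0 : forall i, 0 <= p i.
Let q i := \sum_j A i j * p j.
Hypothesis q_gt0 : forall i, 0 < q i.
Hypothesis Q_poisson : forall i k,
  \sum_j A i j * p j * Q j k = q i * (Q i k - (i == k)%:R + v ord0 k).

(** Increment of the corrected defect [th] when the walk steps from [i] to [j]; the Poisson equation
    makes it centred. *)
Let xi i j k := Q j k - v ord0 k - Q i k + (i == k)%:R.

Let xi_centered i k : \sum_j A i j * p j * xi i j k = 0.
Proof.
rewrite (eq_bigr (fun j => A i j * p j * Q j k - A i j * p j * (v ord0 k + Q i k - (i == k)%:R))).
  by rewrite sumrB Q_poisson -mulr_suml -/(q i); ring.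
by move=> j _; rewrite /xi; ring.
Qed.

Let B := \sum_i \sum_j \sum_k xi i j k ^+ 2.

(* A centred random step increases the expected square norm by a bounded amount, so some
   step of positive probability increases the square norm by at most that amount. *)
Lemma greedy_step (th : 'I_N -> R) i : exists2 j, 0 < A i j &
  \sum_k (th k + xi i j k) ^+ 2 <= \sum_k th k ^+ 2 + B.
Proof.
(* Let [d j] be the change of the square norm minus [B]. Were every admissible [j] to have
   [d j > 0], the terms [A i j * p j * d j] would be nonnegative with sum at most 0, so all
   [A i j * p j] would vanish, against [q i > 0]. *)
apply: contrapT => none.
pose d j := \sum_k 2 * th k * xi i j k + (\sum_k xi i j k ^+ 2 - B).
have dE j : d j = \sum_k (th k + xi i j k) ^+ 2 - (\sum_k th k ^+ 2 + B).
  have -> : \sum_k (th k + xi i j k) ^+ 2 =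
      \sum_k th k ^+ 2 + (\sum_k 2 * th k * xi i j k + \sum_k xi i j k ^+ 2).
    by rewrite -!big_split/=; apply: eq_bigr => k _; ring.
  by rewrite /d; ring.
have xiB j : \sum_k xi i j k ^+ 2 <= B.
  have s0 l m : 0 <= \sum_k xi l m k ^+ 2 by rewrite sumr_ge0// => k _; exact: sqr_ge0.
  apply: (@le_trans _ _ (\sum_j \sum_k xi i j k ^+ 2)).
    by rewrite [leRHS](bigD1 j)//= lerDl sumr_ge0.
  by rewrite /B [leRHS](bigD1 i)//= lerDl sumr_ge0// => l _; rewrite sumr_ge0.
have pos j : 0 <= A i j * p j * d j.
  have [->|Aij] := eqVneq (A i j) 0; first by rewrite !mul0r.
  rewrite !mulr_ge0// dE subr_ge0 leNgt; apply/negP => lt; apply: none.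
  by exists j; [rewrite lt_neqAle eq_sym Aij Anneg|exact: ltW].
have S0 : \sum_j A i j * p j * d j == 0.
  rewrite eq_le sumr_ge0 ?andbT//; under eq_bigr do rewrite mulrDr.
  rewrite big_split/= [X in X + _ <= _](_ : _ = 0) ?add0r.
    by apply: sumr_le0 => j _; rewrite mulr_ge0_le0 ?mulr_ge0// subr_le0.
  under eq_bigr do rewrite mulr_sumr.
  rewrite exchange_big/= big1// => k _.
  under eq_bigr do rewrite mulrCA.
  by rewrite -mulr_sumr xi_centered mulr0.
have : q i = 0.
  rewrite /q big1// => j _; apply/eqP; have [->|Aij] := eqVneq (A i j) 0; first by rewrite mul0r.
  move: S0; rewrite psumr_eq0// => /allP /(_ j (mem_index_enum _))/=.
  rewrite mulf_eq0 => /orP[//|dj0]; case: none; exists j.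
    by rewrite lt_neqAle eq_sym Aij Anneg.
  by rewrite -subr_le0 -dE (eqP dj0).
by apply/eqP; rewrite gt_eqF.
Qed.

(** Occupation defect [Z_n - (n+1) v], plus the Poisson term that centres its increments. *)
Let th x n k := (Zcount x n k)%:R - n.+1%:R * v ord0 k + Q (x n) k - (x n == k)%:R.

Let greedy_path_aux x0 n : exists x : nat -> 'I_N,
  [/\ x 0%N = x0, forall k, (k < n)%N -> 0 < A (x k) (x k.+1) &
  \sum_k th x n k ^+ 2 <= \sum_k th (fun=> x0) 0 k ^+ 2 + n%:R * B].
Proof.
elim: n => [|n [x [xx0 xA xth]]]; first by exists (fun=> x0); split=> //; rewrite mul0r addr0.
have [j Aj Hj] := greedy_step (th x n) (x n).
exists (extend x n j); split=> [|k|].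
- by rewrite extend_le.
- rewrite ltnS leq_eqVlt => /orP[/eqP ->|kn]; first by rewrite extend_last extend_le.
  by rewrite !extend_le ?(ltnW kn)//; exact: xA.
- have E k : th (extend x n j) n.+1 k = th x n k + xi (x n) j k.
    rewrite /th /xi ZcountS extend_last (@eq_Zcount _ _ x) => [|l]; last exact: extend_le.
    rewrite natrD -[n.+2%:R]natr1; ring.
  under eq_bigr do rewrite E.
  by rewrite (le_trans Hj)// -natr1; lra.
Qed.

(** The square norm of [th] grows at most linearly, and dividing by [(n + 1 + N)^2] leaves order
    [1 / n]. The path may depend on [n], but [E] does not. *)
Lemma greedy_path x0 : exists2 E : R, 0 <= E & forall n, exists x : nat -> 'I_N,
  [/\ x 0%N = x0, forall k, (k < n)%N -> 0 < A (x k) (x k.+1) &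
  wprod v (wocc R x n - v) (wocc R x n - v) <= E / (n.+1 + N)%:R].
Proof.
have B0 : 0 <= B by do 3 (rewrite sumr_ge0// => ? _); exact: sqr_ge0.
(* The bounded difference between [(n + 1 + N) (wocc - v)] and [th]. *)
pose s i k := 1 - N%:R * v ord0 k - Q i k + (i == k)%:R.
pose S := \sum_i \sum_k s i k ^+ 2.
have S0 : 0 <= S by do 2 (rewrite sumr_ge0// => ? _); exact: sqr_ge0.
pose T := \sum_k th (fun=> x0) 0 k ^+ 2.
have T0 : 0 <= T by rewrite sumr_ge0// => k _; exact: sqr_ge0.
pose M := \sum_i weight (v ord0 i).
have M0 : 0 <= M by rewrite sumr_ge0// => i _; exact/ltW/weight_gt0.
exists (M * (2 * (T + B + S))); first by rewrite !mulr_ge0// !addr_ge0.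
move=> n; have [x [xx0 xA xth]] := greedy_path_aux x0 n.
exists x; split=> //.
set m : R := (n.+1 + N)%:R.
have m0 : 0 < m by rewrite ltr0n.
have m1 : 1 <= m by rewrite ler1n.
have E k : (wocc R x n - v) ord0 k = (th x n k + s (x n) k) / m.
  rewrite !mxE /th /s -/m; apply: (mulIf (lt0r_neq0 m0)); rewrite mulrBl !divfK ?lt0r_neq0//.
  rewrite /m natrD; ring.
have step1 : wprod v (wocc R x n - v) (wocc R x n - v) <=
    \sum_k M * ((2 * th x n k ^+ 2 + 2 * s (x n) k ^+ 2) / m ^+ 2).
  apply: ler_sum => k _; rewrite E -mulrA -expr2 expr_div_n ler_pM//.
  - exact/ltW/weight_gt0.
  - by rewrite divr_ge0 ?sqr_ge0.
  - by rewrite /M (bigD1 k)//= lerDl sumr_ge0// => i _; exact/ltW/weight_gt0.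
  - rewrite ler_wpM2r ?invr_ge0 ?sqr_ge0//.
    have := sqr_ge0 (th x n k - s (x n) k); lra.
rewrite (le_trans step1)// -mulr_sumr -mulrA ler_wpM2l// -mulr_suml.
rewrite big_split/= -!mulr_sumr expr2 invfM mulrA ler_wpM2r ?invr_ge0 ?(ltW m0)//.
rewrite ler_pdivrMr//.
have h1 : \sum_k s (x n) k ^+ 2 <= S.
  rewrite /S [leRHS](bigD1 (x n))//= lerDl sumr_ge0// => i _.
  by rewrite sumr_ge0// => k _; exact: sqr_ge0.
have h2 : n%:R * B <= m * B by rewrite ler_wpM2r// ler_nat addSn leqW// leq_addr.
have h3 : T <= m * T by rewrite ler_peMl.
have h4 : S <= m * S by rewrite ler_peMl.
rewrite -/T in xth; lra.
Qed.

End Greedy.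

(** * Escape probabilities *)

Section Cylinders.
Variables (R : realType) (N : nat) (d : measure_display) (T : measurableType d).
Variables (P : probability T R) (X : nat -> T -> 'I_N).
Hypothesis Xmeas : forall n i, measurable [set w | X n w = i].

(** Finitely many coordinates with finitely many values: fixing the last one to each [j] leaves an
    event on one coordinate less. *)
Lemma measurable_prefix n (C : (nat -> 'I_N) -> Prop) :
  (forall x y, (forall k, (k < n)%N -> x k = y k) -> C x -> C y) ->
  measurable [set w | C (X ^~ w)].
Proof.
elim: n C => [|n IH] C HC.
  have [[x Cx]|none] := pselect (exists x, C x).
    rewrite [X in measurable X](_ : _ = setT); first exact: measurableT.
    by apply/seteqP; split=> // w _; apply: HC Cx.
  rewrite [X in measurable X](_ : _ = set0); first exact: measurable0.
  by apply/seteqP; split=> // w Cw; apply: none; exists (X ^~ w).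
rewrite [X in measurable X](_ : _ = \bigcup_(j in [set: 'I_N]) ([set w | X n w = j] `&`
    [set w | (fun x => C (fun k => if k == n then j else x k)) (X ^~ w)])).
  apply: fin_bigcup_measurable; first exact: finite_finset.
  move=> j _; apply: measurableI => //.
  apply: (IH (fun x => C (fun k => if k == n then j else x k))) => x y xy; apply: HC => k.
  by rewrite ltnS leq_eqVlt; case: eqVneq => //= _; exact: xy.
apply/seteqP; split=> w /=.
  by move=> Cw; exists (X n w) => //; split=> //; apply: HC Cw => k _; case: eqVneq => // ->.
by move=> [j _ [/= Xj]]; apply: HC => k _; case: eqVneq => // ->.
Qed.

Lemma fine_mono (S S' : set T) : measurable S -> measurable S' -> S `<=` S' ->
  fine (P S) <= fine (P S').
Proof.
move=> mS mS' SS'; rewrite fine_le ?fin_num_measure//.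
by apply: le_measure; rewrite ?inE.
Qed.

Lemma fine_split n (S : set T) : measurable S ->
  fine (P S) = \sum_j fine (P (S `&` [set w | X n w = j])).
Proof.
move=> mS; have m j : measurable (S `&` [set w | X n w = j]) by exact: measurableI.
rewrite {1}(_ : S = \big[setU/set0]_(j < N) (S `&` [set w | X n w = j])).
  rewrite measure_bigsetU_ord//; first by rewrite sum_fine// => j _; exact: fin_num_measure.
  by move=> i j _ _ [w [[_ /= <-] [_ /= <-]]].
apply/seteqP; split=> w; first by move=> Sw; rewrite (bigD1 (X n w))//=; left.
move: w; elim/big_ind: _ => [//|A B HA HB w [/HA|/HB]//|j _ w []//].
Qed.

Definition cylinder (x : nat -> 'I_N) n := [set w | forall k, (k <= n)%N -> X k w = x k].

Lemma measurable_cylinder x n : measurable (cylinder x n).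
Proof.
apply: (@measurable_prefix n.+1 (fun y => forall k, (k <= n)%N -> y k = x k)).
by move=> y z yz H k kn; rewrite -yz ?H.
Qed.

Lemma cylinderS x n j : cylinder x n `&` [set w | X n.+1 w = j] = cylinder (extend x n j) n.+1.
Proof.
apply/seteqP; split=> w.
  move=> [Hx /= Xj] k; rewrite leq_eqVlt ltnS => /orP[/eqP ->|kn]; first by rewrite extend_last.
  by rewrite extend_le// Hx.
move=> H; split=> [k kn|/=]; first by rewrite H ?leqW// extend_le.
by rewrite H// extend_last.
Qed.

Section Escape.
Variables (K : (nat -> 'I_N) -> nat -> 'I_N -> R).
Hypothesis Xlaw : forall n x j, fine (P (cylinder (extend x n j) n.+1)) =
  fine (P (cylinder x n)) * K x n j.
Variables (good : (nat -> 'I_N) -> nat -> Prop) (Y : (nat -> 'I_N) -> nat -> R).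
Variables (r : R) (n0 : nat).
Hypothesis good_prefix : forall x y n, (forall k, (k <= n)%N -> x k = y k) ->
  good x n -> good y n.
Hypothesis r_gt0 : 0 < r.
Hypothesis Y_ge0 : forall x n, (n0 <= n)%N -> good x n -> 0 <= Y x n.
Hypothesis Y_exit : forall x n j, (n0 <= n)%N -> good x n -> ~ good (extend x n j) n.+1 ->
  r <= Y (extend x n j) n.+1.
Hypothesis Y_drift : forall x n, (n0 <= n)%N -> good x n ->
  \sum_j K x n j * Y (extend x n j) n.+1 <= Y x n.

Let exit x n l := cylinder x n `&`
  [set w | exists k, (n < k <= n + l)%N /\ ~ good (X ^~ w) k].

Let measurable_exit x n l : measurable (exit x n l).
Proof.
apply: measurableI; first exact: measurable_cylinder.
apply: (@measurable_prefix (n + l).+1 (fun y => exists k, (n < k <= n + l)%N /\ ~ good y k)).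
move=> y z yz [k [/andP[nk kl] Hk]]; exists k; split; first by rewrite nk.
by apply: contra_not Hk; apply: good_prefix => i ik; rewrite yz// ltnS (leq_trans ik).
Qed.

(** Induction on the horizon, conditioning on the next state: after a good step the induction
    hypothesis applies, after an exit [Y / r >= 1] bounds the probability trivially, and the drift
    of [Y] averages both cases. *)
Let exit_bound l : forall n x, (n0 <= n)%N -> good x n ->
  fine (P (exit x n l)) <= fine (P (cylinder x n)) * (Y x n / r).
Proof.
elim: l => [|l IH] n x n0n gx.
  have -> : exit x n 0 = set0.
    apply/seteqP; split=> // w [_ [k [/andP[nk]]]].
    by rewrite addn0 leqNgt nk.
  by rewrite measure0 mulr_ge0 ?fine_ge0// divr_ge0 ?Y_ge0// ltW.
rewrite (@fine_split n.+1)//.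
apply: (@le_trans _ _ (\sum_j fine (P (cylinder (extend x n j) n.+1)) * (Y (extend x n j) n.+1 / r))).
  apply: ler_sum => j _.
  have P0 : 0 <= fine (P (cylinder (extend x n j) n.+1)) by rewrite fine_ge0.
  have mXj : measurable (exit x n l.+1 `&` [set w | X n.+1 w = j]) by exact: measurableI.
  have mC := measurable_cylinder.
  have [gx'|bx'] := pselect (good (extend x n j) n.+1).
    apply: le_trans (IH _ _ (leqW n0n) gx').
    apply: fine_mono => // w [[Hc [k [/andP[nk kl] Hk]]] Xj].
    have Hc' : cylinder (extend x n j) n.+1 w by rewrite -cylinderS.
    split=> //; exists k; split=> //; rewrite addSnnS kl andbT ltn_neqAle nk andbT.
    apply/eqP => kn; apply: Hk; rewrite -kn; apply: good_prefix gx' => i ik.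
    by rewrite Hc'.
  apply: (@le_trans _ _ (fine (P (cylinder (extend x n j) n.+1)))).
    by apply: fine_mono => // w [[Hc _] Xj]; rewrite -cylinderS.
  by rewrite ler_peMr// ler_pdivlMr// mul1r Y_exit.
under eq_bigr do rewrite Xlaw mulrA -[_ * K _ _ _ * _]mulrA.
rewrite -mulr_suml -mulr_sumr -mulrA ler_wpM2l ?fine_ge0// ler_wpM2r ?invr_ge0 ?(ltW r_gt0)//.
exact: Y_drift.
Qed.

(* Doob's maximal inequality for the supermartingale Y stopped on leaving the good set. *)
Lemma stay_forever x : good x n0 -> Y x n0 < r -> (0 < P (cylinder x n0))%E ->
  let S := [set w | forall k, (n0 <= k)%N -> good (X ^~ w) k] in
  exists2 S', measurable S' /\ S' `<=` S & (0 < P S')%E.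
Proof.
move=> gx Yr Px; cbv zeta.
have mC := measurable_cylinder x n0.
pose F l := cylinder x n0 `\` exit x n0 l.
have mF l : measurable (F l) by exact: measurableD.
have mF' : measurable (\bigcap_l F l) by exact: bigcapT_measurable.
exists (\bigcap_l F l).
  split=> // w Fw k; rewrite leq_eqVlt => /orP[/eqP <-|n0k].
    by apply: good_prefix gx => i ik; have [-> ] := Fw 0%N I.
  apply: contrapT => bk; have [Cw] := Fw k I; apply; split=> //; exists k; split=> //.
  by rewrite n0k leq_addl.
have finC : P (cylinder x n0) \is a fin_num by exact: fin_num_measure.
have px : 0 < fine (P (cylinder x n0)) by rewrite fine_gt0// Px ltey_eq finC.
pose e := fine (P (cylinder x n0)) * (1 - Y x n0 / r).
have e0 : 0 < e by rewrite mulr_gt0// subr_gt0 ltr_pdivrMr// mul1r.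
(* The bound is uniform in [l], so it passes to the decreasing intersection by continuity from
   above. *)
have Fe l : (e%:E <= P (F l))%E.
  have finE : P (exit x n0 l) \is a fin_num by exact: fin_num_measure.
  have -> : P (F l) = (P (cylinder x n0) - P (exit x n0 l))%E.
    rewrite [LHS]measureD//; last by rewrite ltey_eq finC.
    by rewrite (_ : cylinder x n0 `&` exit x n0 l = exit x n0 l)//; apply/setIidr => w [].
  rewrite -(fineK finC) -(fineK finE) -EFinB lee_fin /e mulrBr mulr1 lerD2l lerN2.
  exact: exit_bound.
have cF : P \o F @ \oo --> P (\bigcap_l F l).
  apply: nonincreasing_cvg_mu => //.
    by rewrite ltey_eq fin_num_measure.
  move=> l l' ll'; rewrite subsetEset => w [Cw nE]; split=> // -[_ [k [/andP[nk kl] bk]]].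
  apply: nE; split=> //; exists k; split=> //; rewrite nk (leq_trans kl)// leq_add2l//.
apply: (@lt_le_trans _ _ e%:E); first by rewrite lte_fin.
rewrite -(cvg_lim _ cF)//; apply: lime_ge; first by apply/cvg_ex; exists (P (\bigcap_l F l)).
exact: nearW.
Qed.

End Escape.

End Cylinders.

(** * Divergence of the growth factor *)

Lemma growthE (R : realType) (N : nat) (c : R) n0 n : (n0 <= n)%N ->
  growth N c n0 n = c^-1 - series harmonic (n0.+1 + N)%N + series harmonic (n.+1 + N)%N.
Proof.
elim: n => [|n IH].
  by rewrite leqn0 => /eqP ->; rewrite growth_start subrK.
rewrite leq_eqVlt ltnS => /orP[/eqP <-|n0n]; first by rewrite growth_start subrK.
by rewrite growthS// IH// -addrA (addSn n.+1) seriesSr.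
Qed.

Lemma growth_dvg (R : realType) (N : nat) (c : R) n0 : growth N c n0 n @[n --> \oo] --> +oo.
Proof.
have sN : nondecreasing_seq (series (@harmonic R)).
  by apply: nondecreasing_series => k _ _; exact: harmonic_ge0.
have /cvgryPge H := nondecreasing_dvgn_lt sN (@dvg_harmonic R).
apply/cvgryPge => B.
have [n1 _ Hn1] := H (B - (c^-1 - series harmonic (n0.+1 + N)%N)).
near=> n.
have n0n : (n0 <= n)%N by near: n; exists n0.
have n1n : (n1 <= n)%N by near: n; exists n1.
rewrite growthE// -lerBlDl; apply: Hn1.
by rewrite /= addSn leqW// (leq_trans n1n)// leq_addr.
Unshelve. all: by end_near. Qed.

(** * From confinement in the tube to convergence of the occupation measure *)

Section OccupationLimit.
Variables (R : realType) (N : nat).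
Implicit Types x : nat -> 'I_N.

Lemma Zcount_le x n i : (Zcount x n i <= n.+1)%N.
Proof. by rewrite -(sum_Zcount x n) (bigD1 i)//= leq_addr. Qed.

Lemma occ_wocc_close x n : `|occ R x n - wocc R x n| <= N.+1%:R / (n.+1 + N)%:R.
Proof.
apply: mx_norm_le => [|i j]; first by rewrite divr_ge0.
rewrite (ord1 i) !mxE; have := Zcount_le x n j; rewrite -(ler_nat R).
move: (Zcount x n j)%:R (ler0n R (Zcount x n j)) => z z0.
rewrite natrD -(natr1 N).
move: n.+1%:R (ltr0Sn R n) N%:R (ler0n R N) => s s0 t t0 zs.
have m0 : 0 < s + t by rewrite ltr_pwDl.
have -> : z / s - (1 + z) / (s + t) = (z * t - s) / s / (s + t).
  by field; rewrite !lt0r_neq0.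
rewrite normrM (gtr0_norm (x := (s + t)^-1)) ?invr_gt0// ler_wpM2r ?invr_ge0 ?(ltW m0)//.
rewrite normrM (gtr0_norm (x := s^-1)) ?invr_gt0// ler_pdivrMr//.
have := ler_wpM2r t0 zs; have := mulr_ge0 z0 t0.
rewrite ler_norml; lra.
Qed.

Lemma occ_cvg (v : 'rV[R]_N) x n0 (a : nat -> R) (r : R) :
  (forall i, 0 <= v ord0 i) -> (forall i, v ord0 i <= 1) -> a n @[n --> \oo] --> +oo ->
  (forall n, (n0 <= n)%N -> a n * wprod v (wocc R x n - v) (wocc R x n - v) <= r) ->
  occ R x n @[n --> \oo] --> v.
Proof.
move=> v0 v1 /cvgryPge a_oo Ha; apply/cvgrPdist_le => e e0.
have e20 : 0 < e / 2 by rewrite divr_gt0.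
near=> n.
have n0n : (n0 <= n)%N by near: n; exists n0.
(* Makes [r / a n] at most [(e / 2)^2]; the summand 1 keeps [a n] positive also when [r = 0]. *)
have B1 : `|r| / (e / 2) ^+ 2 + 1 <= a n by near: n; exact: a_oo.
have B2 : N.+1%:R / (n.+1 + N)%:R <= e / 2.
  rewrite ler_pdivrMr ?ltr0n// -ler_pdivrMl// (@le_trans _ _ n%:R)//.
    by near: n; exact: nbhs_infty_ger.
  by rewrite ler_nat addSn leqW// leq_addr.
rewrite -(subrKA (wocc R x n)) (le_trans (ler_normD _ _))// [leRHS]splitr lerD//; last first.
  by rewrite distrC (le_trans (occ_wocc_close x n)).
rewrite distrC -ler_sqr ?nnegrE ?(ltW e20)//.
rewrite (le_trans (sqr_norm_le_wprod v0 v1 _))//.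
have q0 : 0 < `|r| / (e / 2) ^+ 2 + 1 by rewrite ltr_wpDl// divr_ge0 ?sqr_ge0.
have an0 : 0 < a n by rewrite (lt_le_trans q0).
rewrite -(ler_pM2l an0) (le_trans (Ha _ n0n))// (le_trans (ler_norm r))//.
rewrite -ler_pdivrMr ?exprn_gt0//; apply: le_trans B1; by rewrite lerDl.
Unshelve. all: by end_near. Qed.

Lemma measurable_occ_cvg d (T : measurableType d) (X : nat -> T -> 'I_N) (v : 'rV[R]_N) :
  (forall n i, measurable [set w | X n w = i]) ->
  measurable [set w | occ R (X ^~ w) n @[n --> \oo] --> v].
Proof.
move=> Xmeas.
rewrite [X in measurable X](_ : _ = \bigcap_k \bigcup_m \bigcap_(n in [set n | (m <= n)%N])
   [set w | `|v - occ R (X ^~ w) n| <= k.+1%:R^-1]).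
  apply: bigcapT_measurable => k; apply: bigcup_measurable => m _.
  apply: bigcap_measurable; first by exists m => /=.
  move=> n _; apply: (@measurable_prefix _ _ _ _ Xmeas n.+1 (fun x => `|v - occ R x n| <= k.+1%:R^-1)).
  move=> x y xy; congr (`|v - _| <= _); apply/rowP => i; rewrite !mxE.
  by rewrite (@eq_Zcount _ x y)// => l ln; exact: xy.
apply/seteqP; split=> w /=.
  move/cvgrPdist_le => H k _; have k0 : 0 < k.+1%:R^-1 :> R by rewrite invr_gt0.
  by have [m _ Hm] := H _ k0; exists m => // n; exact: Hm.
move=> H; apply/cvgrPdist_le => e e0.
have [k ke] : exists k, k.+1%:R^-1 <= e.
  have /cvgrPdist_le/(_ e e0)[m _ Hm] := @cvg_harmonic R.
  exists m; have := Hm m (leqnn m).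
  by rewrite sub0r normrN ger0_norm ?invr_ge0.
have [m _ Hm] := H k Logic.I.
by exists m => // n mn; apply: le_trans ke; exact: Hm.
Qed.

End OccupationLimit.

(** * Positive probability of admissible initial paths *)

Section PositiveCylinders.
Variables (R : realType) (N : nat) (d : measure_display) (T : measurableType d).
Variables (P : probability T R) (X : nat -> T -> 'I_N).
Hypothesis Xmeas : forall n i, measurable [set w | X n w = i].

Lemma exists_initial_state : exists x0, 0 < fine (P [set w | X 0%N w = x0]).
Proof.
apply: contrapT => none; have := fine_split P Xmeas 0 measurableT.
rewrite probability_setT/= big1 => [|j _]; first by apply/eqP; rewrite oner_eq0.
rewrite setTI; apply/eqP; rewrite eq_le fine_ge0// andbT leNgt.
by apply/negP => pos; apply: none; exists j.
Qed.

Variable K : (nat -> 'I_N) -> nat -> 'I_N -> R.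
Hypothesis Xlaw : forall n x j, fine (P (cylinder X (extend x n j) n.+1)) =
  fine (P (cylinder X x n)) * K x n j.

Lemma cylinder_gt0 x n : 0 < fine (P [set w | X 0%N w = x 0%N]) ->
  (forall k, (k < n)%N -> 0 < K x k (x k.+1)) -> 0 < fine (P (cylinder X x n)).
Proof.
move=> P0; elim: n => [_|n IH HK].
  rewrite (_ : cylinder X x 0 = [set w | X 0%N w = x 0%N])//.
  by apply/seteqP; split=> w /=; [exact|move=> Xw k; rewrite leqn0 => /eqP ->].
rewrite (_ : cylinder X x n.+1 = cylinder X (extend x n (x n.+1)) n.+1).
  by rewrite Xlaw mulr_gt0 ?HK// IH// => k kn; rewrite HK// ltnW.
have E k : (k <= n.+1)%N -> extend x n (x n.+1) k = x k.
  rewrite leq_eqVlt ltnS => /orP[/eqP ->|kn]; [exact: extend_last|exact: extend_le].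
by apply/seteqP; split=> w H k kn; rewrite H// E.
Qed.

End PositiveCylinders.

(** * Reaching the tube and staying in it with positive probability *)

Theorem theorem3p11 (R : realType) (N : nat) (alpha : R) (A : 'M[R]_N)
  (HN : (2 <= N)%N) (Halpha : 1 < alpha)
  (Asym : A^T = A) (Anneg : forall i j, 0 <= A i j)
  (Apos : forall i j, i != j -> 0 < A i j)
  (Arow : forall i i', \sum_j A i j = \sum_j A i' j)
  (d : measure_display) (T : measurableType d) (P : probability T R)
  (X : nat -> T -> 'I_N)
  (Xmeas : forall n i, measurable [set w | X n w = i])
  (Xlaw : forall (n : nat) (x : nat -> 'I_N) (j : 'I_N),
     P [set w | (forall k, (k <= n)%N -> X k w = x k) /\ X n.+1 w = j] =
     (P [set w | forall k, (k <= n)%N -> X k w = x k] *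
      (vrrw_kernel alpha A x n j)%:E)%E)
  (vstar : 'rV[R]_N) (Hstable : linearly_stable alpha A vstar) :
  (0 < P [set w | occ R (fun k => X k w) n @[n --> \oo] --> vstar])%E.
Proof.
have [Heq Hst] := Hstable.
have v0 := equilibrium_ge0 Heq; have v1 := equilibrium_le1 Heq.
have Xlaw' n x j : fine (P (cylinder X (extend x n j) n.+1)) =
    fine (P (cylinder X x n)) * vrrw_kernel alpha A x n j.
  have := Xlaw n x j; rewrite -cylinderS => /(congr1 fine) ->.
  by rewrite fineM// fin_num_measure//; exact: measurable_cylinder.
have [c [rho [C [h [[c0 rho0 C0] hb hl hd]]]]] :=
  lyapunov HN Halpha Asym Anneg Apos Heq Hst.
have [x0 Px0] := exists_initial_state P Xmeas.
have [Q HQ] := equilibrium_poisson Asym Anneg Apos Heq.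
have [E E0 path] := greedy_path Anneg v0 (vpow_ge0 alpha vstar) (equilibrium_Avpow_gt0 Anneg Apos Heq) HQ x0.
pose V (w : 'rV[R]_N) := wprod vstar (w - vstar) (w - vstar).
(* Since [growth >= c^-1], the condition [growth * V <= r] confines the walk to the ball of radius
   [rho / 2]. *)
pose r := c^-1 * (rho / 2) ^+ 2.
have s0 : 0 < rho / 2 by rewrite divr_gt0.
have r0 : 0 < r by rewrite mulr_gt0 ?invr_gt0 ?exprn_gt0.
pose S := c^-1 * (E + 2 * C) + (\sum_i weight (vstar ord0 i) + 6 * C) * (c^-1 + 2).
(* Three thresholds for [n0]: gains at most [rho / 2], a greedy path ending in the tube, and a
   supermartingale starting below [r]. *)
pose L := (rho / 2)^-1 + E / (rho / 2) ^+ 2 + S / r.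
have [n0 Hn0] : exists n0, forall n, (n0 <= n)%N -> L + 1 <= n%:R.
  by have [n0 _ Hn0] := nbhs_infty_ger (L + 1); exists n0.
have S0 : 0 <= S.
  rewrite addr_ge0// mulr_ge0 ?addr_ge0 ?mulr_ge0 ?invr_ge0 ?(ltW c0)//.
  by rewrite sumr_ge0// => i _; exact/ltW/weight_gt0.
have m0 : 0 < (n0.+1 + N)%:R :> R by rewrite ltr0n.
have Lm : L < (n0.+1 + N)%:R.
  have := Hn0 n0 (leqnn _); rewrite addSn -natr1 natrD; have := ler0n R N; lra.
have L1 : 0 <= (rho / 2)^-1 by rewrite invr_ge0 ltW.
have L2 : 0 <= E / (rho / 2) ^+ 2 by rewrite divr_ge0 ?sqr_ge0.
have L3 : 0 <= S / r by rewrite divr_ge0 ?(ltW r0).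
have Em : E / (n0.+1 + N)%:R <= (rho / 2) ^+ 2.
  rewrite ler_pdivrMr// mulrC -ler_pdivrMr ?exprn_gt0//.
  by apply: le_trans (ltW Lm); rewrite /L; lra.
have Sm : S / (n0.+1 + N)%:R < r.
  rewrite ltr_pdivrMr// mulrC -ltr_pdivrMr//.
  by apply: le_lt_trans Lm; rewrite /L; lra.
have gs n : (n0 <= n)%N -> gain R N n <= rho / 2.
  move=> n0n; rewrite -(invrK (rho / 2)) lef_pV2 ?posrE ?invr_gt0 ?ltr0n//.
  have := Hn0 n n0n; rewrite /L !addSn -!natr1 natrD; have := ler0n R N; lra.
have [x [xx0 xA xV]] := path n0.
pose good (y : nat -> 'I_N) n := growth N c n0 n * V (wocc R y n) <= r.
pose Y (y : nat -> 'I_N) n := supermart vstar c C h n0 n (wocc R y n) (y n).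
have ball y n : good y n -> `|wocc R y n - vstar| <= rho / 2 by exact: growth_ball.
have half w : `|w - vstar| <= rho / 2 -> `|w - vstar| <= rho.
  by move=> /le_trans; apply; rewrite ler_pdivrMr// ler_peMr ?ler1n// ltW.
have gx : good x n0.
  by rewrite /good growth_start ler_wpM2l ?invr_ge0 ?(ltW c0)// (le_trans xV).
have [S' [mS' S'good] PS'] : exists2 S', measurable S' /\
    S' `<=` [set w | forall k, (n0 <= k)%N -> good (X ^~ w) k] & (0 < P S')%E.
  apply: (stay_forever Xmeas Xlaw' (r := r) (n0 := n0) (good := good) (Y := Y) _ _ _ _ _ gx) => //.
  - by move=> y z n yz; rewrite /good (eq_wocc _ yz).
  - move=> y n n0n gy; apply: le_trans (supermart_ge v0 c0 C0 hb n0 n _ (half _ (ball _ _ gy))).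
    by rewrite mulr_ge0 ?wprod_ge0// ltW// growth_gt0.
  - move=> y n j n0n gy /negP; rewrite -ltNge => ng.
    apply: (le_trans (ltW ng)); apply: (supermart_ge v0 c0 C0 hb).
    exact: (wocc_extend_ball gs j n0n (ball _ _ gy)).
  - move=> y n n0n gy; rewrite /Y; under eq_bigr do rewrite extend_last.
    exact: (supermart_drift HN Anneg Apos v0 c0 rho0 C0 hb hl hd gs n0n (ball _ _ gy)).
  - apply: le_lt_trans Sm; have := supermart_start c0 C0 hb (x n0) (half _ (ball _ _ gx)) xV; exact.
  (* Every step of the greedy path has a positive entry of [A], and [wocc] is positive, so the
     kernel is positive along it. *)
  - have : 0 < fine (P (cylinder X x n0)).
      apply: (cylinder_gt0 Xlaw'); first by rewrite xx0.
      move=> k kn; rewrite vrrw_kernelE divr_gt0 ?mulr_gt0 ?xA ?vpow_gt0 ?wocc_gt0//.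
      by apply: Avpow_gt0 => // i; exact: wocc_gt0.
    by case: (P _) (measure_ge0 P (cylinder X x n0)) => [p| |]//=; rewrite ?ltxx// lte_fin.
apply: (lt_le_trans PS'); apply: le_measure; rewrite ?inE//.
  exact: measurable_occ_cvg.
by move=> w /S'good Hw; apply: (occ_cvg v0 v1 (@growth_dvg R N c n0) Hw).
Qed.
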